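(* Let $n,m\in\mathbb{N}_0$ with $n\ge m$, let $\nu\in\mathbb{C}\setminus\{2m,2m+2,2m+4,\dots\}$, let $r,r'\in(0,\infty)$ with $r\ne r'$, and let $\theta'\in(0,\pi)$. Then \[ \int_0^\pi (\chi^2-1)^{(\nu+1)/4}\,Q^{-(\nu+1)/2}_{m-1/2}(\chi)\,\mathrm{P}^m_n(\cos\theta)\,(\sin\theta)^{(\nu+2)/2}\,d\theta =\frac{i\sqrt{\pi}}{2^{(\nu+1)/2}(\sin\theta')^{\nu/2}}\left(\frac{r_>^2-r_<^2}{rr'}\right)^{(\nu+2)/2} Q_n^{-(\nu+2)/2}\!\left(\frac{r^2+r'^2}{2rr'}\right)\mathrm{P}^m_n(\cos\theta'), \] where $\chi=\dfrac{r^2+r'^2-2rr'\cos\theta\cos\theta'}{2rr'\sin\theta\sin\theta'}$ and $r_<=\min\{r,r'\}$, $r_>=\max\{r,r'\}$.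
   Context: For $z\in\mathbb{C}\setminus(-\infty,1]$, $Q^\mu_\nu(z)=e^{\mu\pi i}\frac{\sqrt{\pi}\,\Gamma(\nu+\mu+1)(z^2-1)^{\mu/2}}{2^{\nu+1}z^{\nu+\mu+1}}\,\mathbf{F}\!\left(\frac{\nu+\mu}{2}+1,\frac{\nu+\mu+1}{2};\nu+\frac32;\frac{1}{z^2}\right)$ is the associated Legendre function of the second kind, with $\mathbf{F}(a,b;c;x)={}_2F_1(a,b;c;x)/\Gamma(c)$ and principal branches. $\mathrm{P}^\mu_\nu$ is the Ferrers function of the first kind: for $x\in(-1,1)$, $\mathrm{P}^\mu_\nu(x)=\left(\frac{1+x}{1-x}\right)^{\mu/2}\mathbf{F}\!\left(\nu+1,-\nu;1-\mu;\frac{1-x}{2}\right)$; for integers $0\le m\le n$ this equals $(-1)^m(1-x^2)^{m/2}\frac{d^m}{dx^m}P_n(x)$ with $P_n$ the Legendre polynomial. All non-integer powers of positive reals are the positive ones. *)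

(* Defs.v *)
From Stdlib Require Import Reals Factorial.
From Coquelicot Require Import Coquelicot.
Open Scope R_scope.

Definition Cexp (z : C) : C :=
  (exp (Re z) * cos (Im z), exp (Re z) * sin (Im z)).

(* x^w for a positive real base x and complex exponent w (principal value,
   i.e. exp (w ln x)); only ever applied to positive reals x. *)
Definition Crpow (x : R) (w : C) : C := Cexp (w * RtoC (ln x))%C.

Fixpoint Cpoch (a : C) (k : nat) : C :=
  match k with
  | O => 1%C
  | S k' => (Cpoch a k' * (a + RtoC (INR k')))%C
  end.

(* Limit of a complex sequence (defined via iota; meaningful when the limit exists). *)
Definition Clim_seq (u : nat -> C) : C :=
  @iota C_CompleteNormedModule (fun l : C => filterlim u eventually (locally l)).

Definition Cseries (a : nat -> C) : C :=
  @iota C_CompleteNormedModule (fun l : C => is_series (V := C_NormedModule) a l).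

(* Reciprocal Gamma function 1/Gamma(z) (entire), by Gauss' product formula:
   1/Gamma(z) = lim_N z (z+1) ... (z+N) / (N! N^z). *)
Definition rgamma (z : C) : C :=
  Clim_seq (fun N => (Cpoch z (S N) / (RtoC (INR (fact N)) * Crpow (INR N) z))%C).

(* Euler Gamma function (at non-poles). *)
Definition CGamma (z : C) : C := Cinv (rgamma z).

(* Regularized hypergeometric function F(a,b;c;x) = 2F1(a,b;c;x)/Gamma(c)
   = sum_k (a)_k (b)_k / (Gamma(c+k) k!) x^k  (|x| < 1). *)
Definition hyp2F1reg (a b c x : C) : C :=
  Cseries (fun k => (Cpoch a k * Cpoch b k * rgamma (c + RtoC (INR k))
                     / RtoC (INR (fact k)) * x ^ k)%C).

(* Associated Legendre function of the second kind Q^mu_nu(x), for real x > 1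
   (the only arguments used), with the paper's hypergeometric definition. *)
Definition LegendreQ (mu nu : C) (x : R) : C :=
  (Cexp (mu * RtoC PI * Ci) * RtoC (sqrt PI) * CGamma (nu + mu + 1)
   * Crpow (x ^ 2 - 1) (mu / 2)
   / (Crpow 2 (nu + 1) * Crpow x (nu + mu + 1))
   * hyp2F1reg ((nu + mu) / 2 + 1) ((nu + mu + 1) / 2) (nu + RtoC (3 / 2))
               (RtoC (/ (x ^ 2))))%C.

(* Ferrers function of the first kind P^mu_nu(x), for x in (-1,1). *)
Definition FerrersP (mu nu : C) (x : R) : C :=
  (Crpow ((1 + x) / (1 - x)) (mu / 2)
   * hyp2F1reg (nu + 1) (- nu) (1 - mu) (RtoC ((1 - x) / 2)))%C.

(* Main.v *)
(* Put [a = m - nu/2], [d = n - m], [t = cos th], [t' = cos th'] and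
   [x = (r^2 + r'^2)/(2 r r') > 1], so that [chi = (x - t t')/(sin th sin th')].
   In the integrand the powers of [chi^2 - 1] cancel.  Expanding the
   hypergeometric series of Q in powers of [1/chi], and each of these by the
   binomial series in [t t'/x], all dependence on [nu] goes into factors
   [(a)_N x^(-a-N)]: up to constants the integrand is
   [sum_N (a)_N x^-N G_N(t,t') (1-t^2)^m Y(t) sin th], where [G_N] is a
   polynomial kernel with [|G_N| <= 1/N!] and [Y] is the Gegenbauer polynomial
   2F1(-d, d+2m+1; m+1; (1-t)/2), proportional to [(1-t^2)^(-m/2) P^m_n(t)].
   Convergence is uniform, so one may integrate termwise.  The Gegenbauer operator
   [L = (1-t^2) D^2 - 2(m+1) t D] acts identically on both variables of [G_N]
   and is self-adjoint for the weight [(1-t^2)^m]; hence the integral of [G_N]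
   against [Y] is a polynomial eigenfunction of [L], i.e. [c_N Y(t')].  Setting
   [t' = 1] gives [c_N] as a moment of [Y], evaluated by integration by parts;
   it vanishes unless [N = d + 2k], and the remaining series is that of Q on the
   right-hand side. *)

Require Import Defs.
From Stdlib Require Import Reals Lra Lia Factorial.
From Coquelicot Require Import Coquelicot.
Open Scope R_scope.

(* Coquelicot's lemmas produce equations typed in a structure over [R] or [C],
   which [ring] and [field] do not recognise. *)
Ltac eqR := match goal with |- @eq _ ?a ?b => change (@eq R a b) end.
Ltac eqC := match goal with |- @eq _ ?a ?b => change (@eq C a b) end.

(** * Series in normed modules *)

Lemma exp_le_compat x y : x <= y -> exp x <= exp y.
Proof. intros [Hlt|Heq]; [left; apply exp_increasing, Hlt|right; rewrite Heq; reflexivity]. Qed.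

Section NormedSeries.

Context {K : AbsRing}.

Lemma plus_minus_cancel {G : AbelianGroup} (x y : G) : plus (minus x y) y = x.
Proof. unfold minus; rewrite <- plus_assoc, plus_opp_l; apply plus_zero_r. Qed.

Lemma minus_plus_cancel {G : AbelianGroup} (x y : G) : minus (plus x y) y = x.
Proof. apply (plus_reg_r y); apply plus_minus_cancel. Qed.

Lemma sum_n_telescope {G : AbelianGroup} (u : nat -> G) n :
  sum_n (fun k => minus (u (S k)) (u k)) n = minus (u (S n)) (u O).
Proof.
  induction n as [|n IH]; [apply sum_O|].
  rewrite sum_Sn, IH, plus_comm, <- minus_trans; reflexivity.
Qed.

Lemma filterlim_eventually_S {U : UniformSpace} (u : nat -> U) (l : U) :
  filterlim u eventually (locally l) <->
  filterlim (fun n => u (S n)) eventually (locally l).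
Proof.
  split; intros H P HP; destruct (H P HP) as [N HN].
  - exists N; intros n Hn; apply HN; lia.
  - exists (S N); intros [|n] Hn; [lia|apply HN; lia].
Qed.

Lemma filterlim_plus_fun {T : Type} {F : (T -> Prop) -> Prop} {FF : Filter F}
    {V : NormedModule K} (f g : T -> V) (x y : V) :
  filterlim f F (locally x) -> filterlim g F (locally y) ->
  filterlim (fun t => plus (f t) (g t)) F (locally (plus x y)).
Proof. intros Hf Hg; exact (filterlim_comp_2 _ _ _ Hf Hg (filterlim_plus x y)). Qed.

Lemma is_series_telescope {V : NormedModule K} (u : nat -> V) (l : V) :
  filterlim u eventually (locally l) <->
  is_series (fun k => minus (u (S k)) (u k)) (minus l (u O)).
Proof.
  rewrite filterlim_eventually_S; split; intros H.
  - apply (filterlim_ext (fun n => minus (u (S n)) (u O))).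
    { intros n; symmetry; exact (sum_n_telescope u n). }
    apply filterlim_plus_fun; [exact H|apply filterlim_const].
  - rewrite <- (plus_minus_cancel l (u O)).
    apply (filterlim_ext (fun n => plus
      (sum_n (fun k => minus (u (S k)) (u k)) n) (u O))).
    { intros n; rewrite (sum_n_telescope (G := V) u n); apply plus_minus_cancel. }
    apply filterlim_plus_fun; [exact H|apply filterlim_const].
Qed.

Lemma is_series_norm_le {V : NormedModule K} (u : nat -> V) (b : nat -> R) (l : V) (B : R) :
  (forall n, norm (u n) <= b n) -> is_series u l -> is_series b B -> norm l <= B.
Proof.
  intros Hub Hu Hb.
  refine (filterlim_le (F := eventually) (fun n => norm (sum_n u n)) (sum_n b) (norm l) B _ _ Hb).
  - exists O; intros n _; eapply Rle_trans; [apply norm_sum_n_m|].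
    apply sum_n_m_le, Hub.
  - eapply filterlim_comp; [exact Hu|apply filterlim_norm].
Qed.

Lemma sum_n_zero {G : AbelianMonoid} (u : nat -> G) n :
  (forall k, (k <= n)%nat -> u k = zero) -> sum_n u n = zero.
Proof.
  intros Hu; unfold sum_n; rewrite (sum_n_m_ext_loc u (fun _ => zero)).
  - apply sum_n_m_const_zero.
  - intros k [_ Hk]; auto.
Qed.

Lemma is_series_finite {V : NormedModule K} (u : nat -> V) n :
  (forall k, (n < k)%nat -> u k = zero) -> is_series u (sum_n u n).
Proof.
  intros Hu; apply (filterlim_ext_loc (fun _ => sum_n u n)); [|apply filterlim_const].
  exists n; intros p Hp; induction Hp as [|p Hp IH]; [reflexivity|].
  rewrite sum_Sn, <- IH, Hu by lia; symmetry; apply plus_zero_r.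
Qed.

Lemma is_series_shift {V : NormedModule K} (u : nat -> V) d (l : V) :
  (forall k, (k < d)%nat -> u k = zero) ->
  is_series u l <-> is_series (fun k => u (d + k)%nat) l.
Proof.
  intros Hu; destruct d as [|d]; [reflexivity|].
  assert (Hz : sum_n u (pred (S d)) = zero)
    by (apply sum_n_zero; intros; apply Hu; simpl in *; lia).
  split; intros Hl.
  - apply is_series_incr_n; [lia|]; rewrite Hz, plus_zero_r; exact Hl.
  - apply (is_series_decr_n _ (S d)); [lia|].
    rewrite Hz; exact (eq_ind_r (is_series _) Hl (minus_zero_r l)).
Qed.

Lemma is_series_even {V : NormedModule K} (u : nat -> V) (l : V) :
  (forall k, u (2 * k + 1)%nat = zero) -> is_series u l ->
  is_series (fun k => u (2 * k)%nat) l.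
Proof.
  intros Hodd Hu.
  apply (filterlim_ext (fun n => sum_n u (2 * n))).
  - intros n; induction n as [|n IH]; [rewrite !sum_O; reflexivity|].
    assert (Hn : u (S (2 * n)) = zero) by (rewrite <- Nat.add_1_r; apply Hodd).
    rewrite sum_Sn, <- IH; replace (2 * S n)%nat with (S (S (2 * n))) by lia.
    rewrite !sum_Sn, Hn, plus_zero_r; reflexivity.
  - apply (filterlim_comp _ _ _ (fun n => 2 * n)%nat (sum_n u) _ eventually); [|exact Hu].
    apply eventually_subseq; intros; lia.
Qed.

Lemma Weierstrass_M_test {T : Type} {V : NormedModule K}
    (u : nat -> T -> V) (M : nat -> R) (g : T -> V) :
  (forall n t, norm (u n t) <= M n) -> ex_series M ->
  (forall t, is_series (fun n => u n t) (g t)) ->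
  filterlim (fun n t => sum_n (fun k => u k t) n) eventually
    (locally (T := fct_UniformSpace T V) g).
Proof.
  intros Hu [B HB] Hg; apply (filterlim_locally (U := fct_UniformSpace T V)); intros eps.
  destruct (proj2 (is_lim_seq_spec (sum_n M) B) HB eps) as [N HN].
  exists (S N); intros [|n] Hn t; [lia|].
  apply ball_sym, norm_compat1.
  apply Rle_lt_trans with (minus B (sum_n M (S n))).
  - apply (is_series_norm_le (fun k => u (S (S n) + k)%nat t) (fun k => M (S (S n) + k)%nat)).
    + intros k; apply Hu.
    + apply (is_series_incr_n (fun k => u k t)); [lia|].
      exact (eq_ind_r (is_series _) (Hg t) (plus_minus_cancel _ _)).
    + apply is_series_incr_n; [lia|].
      exact (eq_ind_r (is_series _) HB (plus_minus_cancel _ _)).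
  - specialize (HN (S n) ltac:(lia)); apply Rabs_def2 in HN.
    unfold minus, plus, opp; simpl; lra.
Qed.

Lemma filterlim_sum_n {T : Type} {F : (T -> Prop) -> Prop} {FF : Filter F}
    {V : NormedModule K} (u : nat -> T -> V) (v : nat -> V) n :
  (forall k, filterlim (u k) F (locally (v k))) ->
  filterlim (fun t => sum_n (fun k => u k t) n) F (locally (sum_n v n)).
Proof.
  intros Hu; induction n as [|n IH].
  - rewrite sum_O; apply (filterlim_ext (u O)); [|apply Hu].
    intros t; rewrite sum_O; reflexivity.
  - rewrite sum_Sn; apply (filterlim_ext (fun t => plus (sum_n (fun k => u k t) n) (u (S n) t))).
    { intros t; rewrite sum_Sn; reflexivity. }
    apply filterlim_plus_fun; [exact IH|apply Hu].
Qed.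

(* Tannery's theorem. *)
Lemma is_series_dominated_lim {V : CompleteNormedModule K}
    (u : nat -> nat -> V) (M : nat -> R) (s v : nat -> V) :
  (forall n p, norm (u n p) <= M n) -> ex_series M ->
  (forall p, is_series (fun n => u n p) (s p)) ->
  (forall n, filterlim (u n) eventually (locally (v n))) ->
  exists l : V, is_series v l /\ filterlim s eventually (locally l).
Proof.
  intros Hu HM Hs Hv.
  apply (filterlim_switch (U := V) eventually _ eventually _
    (fun n p => sum_n (fun k => u k p) n) s (sum_n v)).
  - apply (Weierstrass_M_test u M s Hu HM Hs).
  - intros n; exact (filterlim_sum_n u v n Hv).
Qed.

Lemma is_series_sum_n {V : NormedModule K} (a : nat -> nat -> V) (s : nat -> V) n :
  (forall k, is_series (fun i => a i k) (s k)) ->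
  is_series (fun i => sum_n (a i) n) (sum_n s n).
Proof.
  intros Ha; apply (filterlim_ext (fun i => sum_n (fun k => sum_n (fun j => a j k) i) n)).
  - intros i; apply sum_n_switch.
  - exact (filterlim_sum_n (fun k => sum_n (fun j => a j k)) s n Ha).
Qed.

Lemma is_series_swap {V : CompleteNormedModule K}
    (a : nat -> nat -> V) (M : nat -> R) (rows cols : nat -> V) :
  (forall i n, norm (sum_n (a i) n) <= M i) -> ex_series M ->
  (forall i, is_series (a i) (rows i)) ->
  (forall k, is_series (fun i => a i k) (cols k)) ->
  exists l : V, is_series rows l /\ is_series cols l.
Proof.
  intros HM EM Hrows Hcols.
  apply (is_series_dominated_lim (fun i n => sum_n (a i) n) M (sum_n cols) rows); auto.
  intros n; exact (is_series_sum_n a cols n Hcols).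
Qed.

Lemma sum_n_le_series (b : nat -> R) (B : R) n :
  (forall k, 0 <= b k) -> is_series b B -> sum_n b n <= B.
Proof.
  intros Hb HB; apply (is_lim_seq_incr_compare (sum_n b)); [exact HB|].
  intros k; rewrite sum_Sn; unfold plus; simpl; specialize (Hb (S k)); lra.
Qed.

Lemma norm_le_exp_sum {V : NormedModule K} (u : nat -> V) (b : nat -> R) n :
  (forall n, norm (minus (u (S n)) (u n)) <= norm (u n) * b n) ->
  norm (u (S n)) <= norm (u O) * exp (sum_n b n).
Proof.
  intros Hu.
  assert (Hratio : forall n, norm (u (S n)) <= norm (u n) * exp (b n)).
  { intros p; rewrite <- (plus_minus_cancel (u (S p)) (u p)).
    eapply Rle_trans; [apply (norm_triangle (V := V))|].
    apply Rle_trans with (norm (u p) * (1 + b p)); [specialize (Hu p); lra|].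
    apply Rmult_le_compat_l; [apply norm_ge_0|apply exp_ineq1_le]. }
  induction n as [|n IH]; [rewrite sum_O; apply Hratio|].
  rewrite sum_Sn; unfold plus; simpl; rewrite exp_plus, <- Rmult_assoc.
  eapply Rle_trans; [apply Hratio|].
  apply Rmult_le_compat_r; [left; apply exp_pos|exact IH].
Qed.

Lemma filterlim_relative_increment {V : CompleteNormedModule K} (u : nat -> V) (b : nat -> R) :
  (forall n, norm (minus (u (S n)) (u n)) <= norm (u n) * b n) ->
  (forall n, 0 <= b n) -> ex_series b ->
  exists l : V, filterlim u eventually (locally l).
Proof.
  intros Hu Hb [B HB].
  assert (HB0 : 0 <= B).
  { eapply Rle_trans; [apply (Hb O)|]; rewrite <- (sum_O b); apply sum_n_le_series; auto. }
  assert (Hbound : forall n, norm (u n) <= norm (u O) * exp B).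
  { intros [|n].
    - pose proof (norm_ge_0 (u O)); pose proof (exp_ineq1_le B); nra.
    - eapply Rle_trans; [apply (norm_le_exp_sum u b n Hu)|].
      apply Rmult_le_compat_l; [apply norm_ge_0|apply exp_le_compat, sum_n_le_series; auto]. }
  destruct (ex_series_le (fun n => minus (u (S n)) (u n))
    (fun n => norm (u O) * exp B * b n)) as [l Hl].
  - intros n; eapply Rle_trans; [apply Hu|]; apply Rmult_le_compat_r; auto.
  - apply (ex_series_scal (V := R_NormedModule)); exists B; exact HB.
  - exists (plus l (u O)); apply (is_series_telescope (V := V)).
    exact (eq_ind_r (is_series _) Hl (minus_plus_cancel l (u O))).
Qed.

End NormedSeries.

Lemma is_RInt_sum_n {V : NormedModule R_AbsRing} (u : nat -> R -> V) (J : nat -> V) a b n :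
  (forall k, is_RInt (u k) a b (J k)) ->
  is_RInt (fun t => sum_n (fun k => u k t) n) a b (sum_n J n).
Proof.
  intros HJ; induction n as [|n IH].
  - rewrite sum_O; apply (is_RInt_ext (u O)); [|apply HJ].
    intros t _; rewrite sum_O; reflexivity.
  - rewrite sum_Sn.
    apply (is_RInt_ext (fun t => plus (sum_n (fun k => u k t) n) (u (S n) t))).
    { intros t _; rewrite sum_Sn; reflexivity. }
    apply is_RInt_plus; [exact IH|apply HJ].
Qed.

Lemma is_RInt_series {V : CompleteNormedModule R_AbsRing}
    (u : nat -> R -> V) (M : nat -> R) (J : nat -> V) (g : R -> V) a b :
  (forall n t, norm (u n t) <= M n) -> ex_series M ->
  (forall n, is_RInt (u n) a b (J n)) ->
  (forall t, is_series (fun n => u n t) (g t)) ->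
  exists l : V, is_series J l /\ is_RInt g a b l.
Proof.
  intros Hu HM HJ Hg.
  apply (filterlim_RInt (fun n t => sum_n (fun k => u k t) n) a b eventually _ g (sum_n J)).
  - intros n; exact (is_RInt_sum_n u J a b n HJ).
  - exact (Weierstrass_M_test u M g Hu HM Hg).
Qed.

(** * Polynomial functions *)

(* Only the calculus of polynomials is used, so they are described as the
   functions some iterated derivative of which vanishes identically. *)
Fixpoint degree_lt (n : nat) (f : R -> R) : Prop :=
  match n with
  | O => forall t, f t = 0
  | S n' => (forall t, ex_derive f t) /\ degree_lt n' (Derive f)
  end.

Definition polynomial (f : R -> R) : Prop := exists n, degree_lt n f.

Lemma degree_lt_ext n f g : (forall t, f t = g t) -> degree_lt n f -> degree_lt n g.
Proof.
  revert f g; induction n as [|n IH]; intros f g Hfg Hf; simpl in *.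
  - intros t; rewrite <- Hfg; auto.
  - destruct Hf as [Hd Hn]; split.
    + intros t; apply (ex_derive_ext f); auto.
    + apply (IH (Derive f)); [|exact Hn]; intros t; apply Derive_ext, Hfg.
Qed.

Lemma degree_lt_zero n : degree_lt n (fun _ => 0).
Proof.
  induction n as [|n IH]; simpl; [reflexivity|split].
  - intros t; apply ex_derive_const.
  - apply (degree_lt_ext n (fun _ => 0)); [|exact IH].
    intros t; symmetry; apply Derive_const.
Qed.

Lemma degree_lt_le n p f : (n <= p)%nat -> degree_lt n f -> degree_lt p f.
Proof.
  revert p f; induction n as [|n IH]; intros p f Hnp Hf.
  - apply (degree_lt_ext p (fun _ => 0)); [|apply degree_lt_zero].
    intros t; symmetry; apply Hf.
  - destruct p as [|p]; [lia|]; destruct Hf as [Hd Hn].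
    split; [exact Hd|apply IH; [lia|exact Hn]].
Qed.

Lemma degree_lt_ex_derive n f t : degree_lt n f -> ex_derive f t.
Proof. intros Hf; apply (degree_lt_le n (S n)) in Hf; [apply Hf|lia]. Qed.

Lemma degree_lt_plus n f g :
  degree_lt n f -> degree_lt n g -> degree_lt n (fun t => f t + g t).
Proof.
  revert f g; induction n as [|n IH]; intros f g Hf Hg.
  - intros t; rewrite Hf, Hg; ring.
  - destruct Hf as [Hf1 Hf2]; destruct Hg as [Hg1 Hg2]; split.
    + intros t; apply @ex_derive_plus; auto.
    + apply (degree_lt_ext n (fun t => Derive f t + Derive g t)); [|auto].
      intros t; symmetry; apply Derive_plus; auto.
Qed.

Lemma degree_lt_mult p n1 n2 f g : (n1 + n2 <= p)%nat ->
  degree_lt n1 f -> degree_lt n2 g -> degree_lt p (fun t => f t * g t).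
Proof.
  revert n1 n2 f g; induction p as [|p IH]; intros n1 n2 f g Hp Hf Hg.
  - assert (n1 = O) by lia; subst; intros t; rewrite Hf; ring.
  - pose proof (fun t => degree_lt_ex_derive n1 f t Hf) as Df.
    pose proof (fun t => degree_lt_ex_derive n2 g t Hg) as Dg.
    destruct n1 as [|n1].
    { apply (degree_lt_ext _ (fun _ => 0)); [|apply degree_lt_zero].
      intros t; rewrite Hf; ring. }
    destruct n2 as [|n2].
    { apply (degree_lt_ext _ (fun _ => 0)); [|apply degree_lt_zero].
      intros t; rewrite Hg; ring. }
    split; [intros t; apply @ex_derive_mult; auto|].
    apply (degree_lt_ext p (fun t => Derive f t * g t + f t * Derive g t)).
    { intros t; symmetry; apply Derive_mult; auto. }
    apply degree_lt_plus; [apply (IH n1 (S n2))|apply (IH (S n1) n2)];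
      first [lia|assumption|apply Hf|apply Hg].
Qed.

Lemma polynomial_ext f g :
  (forall t, f t = g t) -> polynomial f -> polynomial g.
Proof. intros Hfg [n Hn]; exists n; apply (degree_lt_ext n f); auto. Qed.

Lemma polynomial_const c : polynomial (fun _ => c).
Proof.
  exists 1%nat; split; [intros t; apply ex_derive_const|].
  intros t; apply Derive_const.
Qed.

Lemma polynomial_id : polynomial (fun t => t).
Proof.
  exists 2%nat; split; [intros t; apply ex_derive_id|].
  apply (degree_lt_ext 1 (fun _ => 1)); [intros t; symmetry; apply Derive_id|].
  split; [intros t; apply ex_derive_const|intros t; apply Derive_const].
Qed.

Lemma polynomial_plus f g :
  polynomial f -> polynomial g -> polynomial (fun t => f t + g t).
Proof.
  intros [a Ha] [b Hb]; exists (a + b)%nat; apply degree_lt_plus.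
  - apply (degree_lt_le a); [lia|exact Ha].
  - apply (degree_lt_le b); [lia|exact Hb].
Qed.

Lemma polynomial_mult f g :
  polynomial f -> polynomial g -> polynomial (fun t => f t * g t).
Proof. intros [a Ha] [b Hb]; exists (a + b)%nat; apply (degree_lt_mult _ a b); auto. Qed.

Lemma polynomial_opp f : polynomial f -> polynomial (fun t => - f t).
Proof.
  intros Hf; apply (polynomial_ext (fun t => (-1) * f t)); [intros; ring|].
  apply polynomial_mult; [apply polynomial_const|exact Hf].
Qed.

Lemma polynomial_minus f g :
  polynomial f -> polynomial g -> polynomial (fun t => f t - g t).
Proof. intros; apply polynomial_plus; [|apply polynomial_opp]; auto. Qed.

Lemma polynomial_pow f k : polynomial f -> polynomial (fun t => f t ^ k).
Proof.
  intros Hf; induction k as [|k IH]; simpl; [apply polynomial_const|].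
  apply polynomial_mult; auto.
Qed.

Lemma polynomial_sum (f : nat -> R -> R) K : (forall k, polynomial (f k)) ->
  polynomial (fun t => sum_f_R0 (fun k => f k t) K).
Proof.
  intros Hf; induction K as [|K IH]; simpl; [apply Hf|].
  apply polynomial_plus; auto.
Qed.

Lemma polynomial_Derive f : polynomial f -> polynomial (Derive f).
Proof.
  intros [n Hn]; exists n; apply (degree_lt_le n (S n)) in Hn; [apply Hn|lia].
Qed.

Lemma polynomial_ex_derive f t : polynomial f -> ex_derive f t.
Proof. intros [n Hn]; apply (degree_lt_ex_derive n f t Hn). Qed.

Lemma polynomial_continuous f t : polynomial f -> continuous f t.
Proof.
  intros Hf; apply (ex_derive_continuous (K := R_AbsRing) (V := R_NormedModule)).
  apply polynomial_ex_derive, Hf.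
Qed.

Create HintDb poly.
#[local] Hint Resolve polynomial_const polynomial_id polynomial_plus
  polynomial_mult polynomial_opp polynomial_minus polynomial_pow
  polynomial_sum polynomial_Derive polynomial_ex_derive : poly.

Lemma polynomial_ex_RInt f a b : polynomial f -> ex_RInt f a b.
Proof.
  intros Hf; apply @ex_RInt_continuous; intros; apply polynomial_continuous, Hf.
Qed.

Lemma RInt_Derive_polynomial f a b : polynomial f -> RInt (Derive f) a b = f b - f a.
Proof.
  intros Hf; apply RInt_Derive; intros t _; [apply polynomial_ex_derive, Hf|].
  apply polynomial_continuous, polynomial_Derive, Hf.
Qed.

Lemma RInt_polynomial_lincomb (f g : R -> R) a b u v : polynomial f -> polynomial g ->
  RInt (fun t => u * f t + v * g t) a b = u * RInt f a b + v * RInt g a b.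
Proof.
  intros Hf Hg; apply is_RInt_unique.
  apply @is_RInt_plus; apply @is_RInt_scal, @RInt_correct, polynomial_ex_RInt; auto.
Qed.

(** * Gegenbauer operators and polynomials *)

Definition gegenbauer_op (mu : R) (f : R -> R) (t : R) : R :=
  (1 - t ^ 2) * Derive (Derive f) t - 2 * (mu + 1) * t * Derive f t.

Lemma polynomial_gegenbauer_op mu f : polynomial f -> polynomial (gegenbauer_op mu f).
Proof. intros Hf; unfold gegenbauer_op; auto 10 with poly. Qed.

#[local] Hint Resolve polynomial_gegenbauer_op : poly.

Lemma gegenbauer_op_ext mu f g t : (forall u, f u = g u) ->
  gegenbauer_op mu f t = gegenbauer_op mu g t.
Proof.
  intros Hfg; unfold gegenbauer_op.
  rewrite (Derive_ext f g) by exact Hfg.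
  rewrite (Derive_ext (Derive f) (Derive g)); [reflexivity|].
  intros u; apply Derive_ext, Hfg.
Qed.

Lemma Derive_lincomb f g u v t : ex_derive f t -> ex_derive g t ->
  Derive (fun t => u * f t + v * g t) t = u * Derive f t + v * Derive g t.
Proof.
  intros Hf Hg; rewrite Derive_plus, !Derive_scal; auto using ex_derive_scal.
Qed.

Lemma gegenbauer_op_lincomb mu f g u v t : polynomial f -> polynomial g ->
  gegenbauer_op mu (fun t => u * f t + v * g t) t
  = u * gegenbauer_op mu f t + v * gegenbauer_op mu g t.
Proof.
  intros Hf Hg; unfold gegenbauer_op.
  rewrite (Derive_ext (Derive _) (fun t => u * Derive f t + v * Derive g t)).
  - rewrite !Derive_lincomb by auto with poly; ring.
  - intros s; apply Derive_lincomb; auto with poly.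
Qed.

Lemma gegenbauer_op_sum mu (c : nat -> R) (f : nat -> R -> R) K t :
  (forall k, polynomial (f k)) ->
  gegenbauer_op mu (fun t => sum_f_R0 (fun k => c k * f k t) K) t
  = sum_f_R0 (fun k => c k * gegenbauer_op mu (f k) t) K.
Proof.
  intros Hf; induction K as [|K IH]; simpl.
  - rewrite (gegenbauer_op_ext mu _ (fun t => c O * f O t + 0 * f O t)) by (intros; ring).
    rewrite gegenbauer_op_lincomb by auto; ring.
  - rewrite (gegenbauer_op_ext mu _ (fun t =>
      1 * sum_f_R0 (fun k => c k * f k t) K + c (S K) * f (S K) t)) by (intros; ring).
    rewrite gegenbauer_op_lincomb, IH by auto with poly; ring.
Qed.

Lemma Derive_gegenbauer_op mu f t : polynomial f ->
  Derive (gegenbauer_op mu f) t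
  = gegenbauer_op (mu + 1) (Derive f) t - 2 * (mu + 1) * Derive f t.
Proof.
  intros Hf; apply is_derive_unique; unfold gegenbauer_op.
  auto_derive.
  - repeat split; auto with poly.
  - change (fun x => Derive (Derive f) x) with (Derive (Derive f)).
    change (fun x => Derive f x) with (Derive f); ring.
Qed.

Lemma Derive_zero_const (f : R -> R) :
  (forall t, ex_derive f t) -> (forall t, Derive f t = 0) -> forall s t, f s = f t.
Proof.
  intros Hd Hf.
  assert (Hz : forall t, is_derive f t 0)
    by (intros t; rewrite <- (Hf t); apply Derive_correct, Hd).
  intros s t; destruct (Rtotal_order s t) as [Hlt|[Heq|Hgt]];
    [|subst; reflexivity|symmetry]; apply @eq_is_derive; auto.
Qed.

(* The derivative of an eigenfunction is an eigenfunction with [mu] raised by one,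
   and at [t = 1] the equation gives [f' 1] from [f 1]; so an eigenfunction
   vanishing at 1 has all its derivatives vanishing there. *)
Lemma gegenbauer_op_eigen_zero n (mu lam : R) f : degree_lt n f -> -1 < mu ->
  (forall t, gegenbauer_op mu f t = lam * f t) -> f 1 = 0 -> forall t, f t = 0.
Proof.
  revert mu lam f; induction n as [|n IH]; intros mu lam f Hf Hmu Hop Hf1; [exact Hf|].
  assert (Pf : polynomial f) by (exists (S n); exact Hf).
  assert (Hder : forall t, Derive f t = 0).
  { apply (IH (mu + 1) (lam + 2 * (mu + 1))); [apply Hf|lra| |].
    - intros t.
      assert (Hop' : Derive (gegenbauer_op mu f) t = lam * Derive f t).
      { rewrite (Derive_ext _ _ t Hop); apply Derive_scal. }
      rewrite Derive_gegenbauer_op in Hop' by exact Pf; lra.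
    - specialize (Hop 1); unfold gegenbauer_op in Hop; rewrite Hf1 in Hop.
      apply Rmult_eq_reg_l with (2 * (mu + 1)); lra. }
  intros t; rewrite <- Hf1; apply Derive_zero_const; auto with poly.
Qed.

(* Coefficients of [2F1(-d, d+2mu+1; mu+1; y)] in powers of [y = (1-t)/2]. *)
Fixpoint gegenbauer_coef (d : nat) (mu : R) (l : nat) : R :=
  match l with
  | O => 1
  | S l' => gegenbauer_coef d mu l' * ((INR l' - INR d) * (INR l' + INR d + 2 * mu + 1))
            / ((INR l' + 1) * (INR l' + mu + 1))
  end.

Definition gegenbauer_trunc (d : nat) (mu : R) (K : nat) (t : R) : R :=
  sum_f_R0 (fun l => gegenbauer_coef d mu l * ((1 - t) / 2) ^ l) K.

(* The Gegenbauer polynomial of degree [d] and index [mu + 1/2], normalised to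
   take the value 1 at 1. *)
Definition gegenbauer (d : nat) (mu : R) : R -> R := gegenbauer_trunc d mu d.

Definition gegenbauer_eigenvalue (d : nat) (mu : R) : R := - (INR d * (INR d + 2 * mu + 1)).

Lemma polynomial_half_pow l : polynomial (fun t => ((1 - t) / 2) ^ l).
Proof. unfold Rdiv; auto with poly. Qed.

#[local] Hint Resolve polynomial_half_pow : poly.

Lemma polynomial_gegenbauer_trunc d mu K : polynomial (gegenbauer_trunc d mu K).
Proof. unfold gegenbauer_trunc; auto 10 with poly. Qed.

Lemma polynomial_gegenbauer d mu : polynomial (gegenbauer d mu).
Proof. apply polynomial_gegenbauer_trunc. Qed.

#[local] Hint Resolve polynomial_gegenbauer_trunc polynomial_gegenbauer : poly.

Lemma Derive_half_pow l t :
  Derive (fun t => ((1 - t) / 2) ^ l) t = - (INR l / 2) * ((1 - t) / 2) ^ pred l.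
Proof. apply is_derive_unique; auto_derive; auto; unfold Rdiv, Rminus; ring. Qed.

Lemma gegenbauer_op_half_pow mu l t :
  gegenbauer_op mu (fun t => ((1 - t) / 2) ^ l) t
  = INR l * (INR l + mu) * ((1 - t) / 2) ^ pred l
    - INR l * (INR l + 2 * mu + 1) * ((1 - t) / 2) ^ l.
Proof.
  unfold gegenbauer_op.
  rewrite (Derive_ext (Derive _) _ t (Derive_half_pow l)), Derive_scal, !Derive_half_pow.
  set (y := (1 - t) / 2); replace t with (1 - 2 * y) by (unfold y; field).
  destruct l as [|[|l]]; simpl pred; rewrite ?S_INR; simpl; field.
Qed.

Lemma gegenbauer_coef_S d mu l : -1 < mu ->
  (INR (S l) * (INR (S l) + mu)) * gegenbauer_coef d mu (S l)
  = gegenbauer_coef d mu l * ((INR l - INR d) * (INR l + INR d + 2 * mu + 1)).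
Proof.
  intros Hmu; pose proof (pos_INR l).
  simpl gegenbauer_coef; rewrite S_INR; field; lra.
Qed.

Lemma gegenbauer_op_trunc d mu K t : -1 < mu ->
  gegenbauer_op mu (gegenbauer_trunc d mu K) t
  = gegenbauer_eigenvalue d mu * gegenbauer_trunc d mu K t
    - (INR K - INR d) * (INR K + INR d + 2 * mu + 1)
      * gegenbauer_coef d mu K * ((1 - t) / 2) ^ K.
Proof.
  intros Hmu; unfold gegenbauer_eigenvalue, gegenbauer_trunc.
  rewrite gegenbauer_op_sum by auto with poly.
  induction K as [|K IH]; [cbn [sum_f_R0]; rewrite gegenbauer_op_half_pow; simpl; ring|].
  rewrite !tech5, IH, gegenbauer_op_half_pow.
  pose proof (gegenbauer_coef_S d mu K Hmu) as Hc; simpl pred.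
  set (y := (1 - t) / 2) in *; set (c := gegenbauer_coef d mu (S K)) in *.
  transitivity (- (INR d * (INR d + 2 * mu + 1))
      * sum_f_R0 (fun l => gegenbauer_coef d mu l * y ^ l) K
    + (INR (S K) * (INR (S K) + mu) * c - gegenbauer_coef d mu K
        * ((INR K - INR d) * (INR K + INR d + 2 * mu + 1))) * y ^ K
    - INR (S K) * (INR (S K) + 2 * mu + 1) * c * y ^ S K); [ring|].
  rewrite Hc; ring.
Qed.

Lemma gegenbauer_op_gegenbauer d mu t : -1 < mu ->
  gegenbauer_op mu (gegenbauer d mu) t = gegenbauer_eigenvalue d mu * gegenbauer d mu t.
Proof. intros Hmu; unfold gegenbauer; rewrite gegenbauer_op_trunc by exact Hmu; ring. Qed.

Lemma gegenbauer_at_1 d mu : gegenbauer d mu 1 = 1.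
Proof.
  unfold gegenbauer; generalize d at 2; intros K; unfold gegenbauer_trunc.
  induction K as [|K IH]; simpl in *; [ring|].
  rewrite IH; replace ((1 - 1) / 2) with 0 by field; ring.
Qed.

Lemma gegenbauer_coef_high d mu l : (d < l)%nat -> gegenbauer_coef d mu l = 0.
Proof.
  intros Hl; induction Hl as [|l Hl IH]; simpl; [|rewrite IH]; unfold Rdiv; ring.
Qed.

Lemma gegenbauer_op_eigen_unique d mu f : -1 < mu -> polynomial f ->
  (forall t, gegenbauer_op mu f t = gegenbauer_eigenvalue d mu * f t) ->
  forall t, f t = f 1 * gegenbauer d mu t.
Proof.
  intros Hmu Pf Hop t.
  assert (Pg : polynomial (fun t => 1 * f t + - f 1 * gegenbauer d mu t)) by auto with poly.
  destruct Pg as [n Hn].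
  enough (1 * f t + - f 1 * gegenbauer d mu t = 0) by lra.
  apply (gegenbauer_op_eigen_zero n mu (gegenbauer_eigenvalue d mu)
    (fun t => 1 * f t + - f 1 * gegenbauer d mu t) Hn Hmu).
  - intros s; rewrite gegenbauer_op_lincomb, Hop, gegenbauer_op_gegenbauer by auto with poly; ring.
  - rewrite gegenbauer_at_1; ring.
Qed.

Lemma Derive_gegenbauer d mu t : -1 < mu ->
  Derive (gegenbauer (S d) mu) t
  = - gegenbauer_eigenvalue (S d) mu / (2 * (mu + 1)) * gegenbauer d (mu + 1) t.
Proof.
  intros Hmu; set (Y := gegenbauer (S d) mu); set (E := gegenbauer_eigenvalue (S d) mu).
  assert (HY : polynomial Y) by (unfold Y; auto with poly).
  assert (Hop : forall t, gegenbauer_op mu Y t = E * Y t)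
    by (intros; apply gegenbauer_op_gegenbauer, Hmu).
  replace (- E / (2 * (mu + 1))) with (Derive Y 1).
  - apply gegenbauer_op_eigen_unique; [lra|auto with poly|].
    intros s; pose proof (Derive_gegenbauer_op mu Y s HY) as HD.
    rewrite (Derive_ext _ _ s Hop), Derive_scal in HD.
    unfold E, gegenbauer_eigenvalue in HD; unfold gegenbauer_eigenvalue.
    rewrite S_INR in HD; lra.
  - specialize (Hop 1); unfold gegenbauer_op, Y in Hop; rewrite gegenbauer_at_1 in Hop.
    fold Y in Hop; apply Rmult_eq_reg_l with (2 * (mu + 1)); [field_simplify; lra|lra].
Qed.

(** * Moments for the weight (1 - t^2)^m *)

Definition weighted_inner (m : nat) (f g : R -> R) : R :=
  RInt (fun t => f t * g t * (1 - t ^ 2) ^ m) (-1) 1.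

Lemma weighted_inner_ext m f f' g g' : (forall t, f t = f' t) -> (forall t, g t = g' t) ->
  weighted_inner m f g = weighted_inner m f' g'.
Proof. intros Hf Hg; apply RInt_ext; intros t _; rewrite Hf, Hg; reflexivity. Qed.

Lemma weighted_inner_sym m f g : weighted_inner m f g = weighted_inner m g f.
Proof. apply RInt_ext; intros t _; rewrite (Rmult_comm (f t)); reflexivity. Qed.

Lemma weighted_inner_lincomb m f g h u v : polynomial f -> polynomial g -> polynomial h ->
  weighted_inner m (fun t => u * f t + v * g t) h
  = u * weighted_inner m f h + v * weighted_inner m g h.
Proof.
  intros Hf Hg Hh; unfold weighted_inner; rewrite <- RInt_polynomial_lincomb by auto 10 with poly.
  apply RInt_ext; intros t _; eqR; ring.
Qed.

Lemma weighted_inner_scal m f g u v : polynomial f -> polynomial g ->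
  weighted_inner m (fun t => u * f t) (fun t => v * g t) = u * v * weighted_inner m f g.
Proof.
  intros Hf Hg; unfold weighted_inner.
  rewrite <- (RInt_scal (V := R_CompleteNormedModule))
    by (apply polynomial_ex_RInt; auto with poly).
  apply RInt_ext; intros t _; unfold scal; simpl; unfold mult; simpl; eqR; ring.
Qed.

Lemma weighted_inner_sum m (c : nat -> R) (f : nat -> R -> R) g K :
  (forall k, polynomial (f k)) -> polynomial g ->
  weighted_inner m (fun t => sum_f_R0 (fun k => c k * f k t) K) g
  = sum_f_R0 (fun k => c k * weighted_inner m (f k) g) K.
Proof.
  intros Hf Hg; induction K as [|K IH]; simpl.
  - rewrite (weighted_inner_ext m _ (fun t => c O * f O t) g (fun t => 1 * g t)) by (intros; ring).
    rewrite weighted_inner_scal by auto; ring.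
  - rewrite (weighted_inner_ext m _ (fun t =>
      1 * sum_f_R0 (fun k => c k * f k t) K + c (S K) * f (S K) t) g g) by (intros; ring).
    rewrite weighted_inner_lincomb, IH by auto with poly; ring.
Qed.

(* The operator is in divergence form:
   [(1-t^2)^m * gegenbauer_op m g = ((1-t^2)^(m+1) * g')']. *)
Lemma weighted_inner_gegenbauer_op m f g : polynomial f -> polynomial g ->
  weighted_inner m f (gegenbauer_op (INR m) g)
  = - weighted_inner (S m) (Derive f) (Derive g).
Proof.
  intros Hf Hg; unfold weighted_inner.
  set (F := fun t => f t * Derive g t * (1 - t ^ 2) ^ S m).
  assert (HF : RInt (Derive F) (-1) 1 = 0).
  { rewrite RInt_Derive_polynomial by (unfold F; auto 10 with poly); unfold F; simpl; ring. }
  rewrite (RInt_ext _ (fun t => 1 * (f t * gegenbauer_op (INR m) g t * (1 - t ^ 2) ^ m)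
    + 1 * (Derive f t * Derive g t * (1 - t ^ 2) ^ S m))) in HF.
  - rewrite RInt_polynomial_lincomb in HF by auto 10 with poly; lra.
  - intros t _; apply is_derive_unique; unfold F; auto_derive.
    + repeat split; auto with poly.
    + unfold gegenbauer_op; change (fun x => Derive g x) with (Derive g).
      change (fun x => f x) with f.
      replace (1 + - (t * (t * 1))) with (1 - t ^ 2) by ring.
      change (match m with O => 1 | S _ => INR m + 1 end) with (INR (S m)).
      rewrite S_INR; simpl pow; ring.
Qed.

Lemma gegenbauer_op_selfadjoint m f g : polynomial f -> polynomial g ->
  weighted_inner m (gegenbauer_op (INR m) f) g = weighted_inner m f (gegenbauer_op (INR m) g).
Proof.
  intros Hf Hg.
  rewrite weighted_inner_sym, !weighted_inner_gegenbauer_op by auto.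
  rewrite weighted_inner_sym; reflexivity.
Qed.

Fixpoint Rpoch (a : R) (k : nat) : R :=
  match k with O => 1 | S k' => Rpoch a k' * (a + INR k') end.

Lemma Rpoch_pos a k : 0 < a -> 0 < Rpoch a k.
Proof.
  intros Ha; induction k; simpl; [lra|].
  apply Rmult_lt_0_compat; auto; pose proof (pos_INR k); lra.
Qed.

Lemma Rpoch_add a j k : Rpoch a (j + k) = Rpoch a j * Rpoch (a + INR j) k.
Proof.
  induction k as [|k IH]; [rewrite Nat.add_0_r; simpl; ring|].
  rewrite Nat.add_succ_r; simpl; rewrite IH, plus_INR; ring.
Qed.

Lemma Derive_id_pow k t : Derive (fun t => t ^ k) t = INR k * t ^ pred k.
Proof. apply is_derive_unique; auto_derive; auto; ring. Qed.

Definition power_moment (m k : nat) : R := RInt (fun t => t ^ k * (1 - t ^ 2) ^ m) (-1) 1.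

Lemma power_moment_S m k :
  (INR k + 1) * power_moment (S m) k = 2 * (INR m + 1) * power_moment m (S (S k)).
Proof.
  pose proof (weighted_inner_gegenbauer_op m (fun t => t ^ S k) (fun t => t)
    ltac:(auto with poly) ltac:(auto with poly)) as Green.
  rewrite (weighted_inner_ext m _ (fun t => 1 * t ^ S k) _
    (fun t => -2 * (INR m + 1) * t)) in Green.
  2:{ intros t; ring. }
  2:{ intros t; unfold gegenbauer_op; rewrite Derive_id.
      rewrite (Derive_ext _ (fun _ => 1)), Derive_const by apply Derive_id; ring. }
  rewrite (weighted_inner_ext (S m) _ (fun t => INR (S k) * t ^ k) _ (fun _ => 1 * 1)) in Green.
  2:{ intros t; apply Derive_id_pow. }
  2:{ intros t; rewrite Derive_id; ring. }
  rewrite !weighted_inner_scal in Green by auto with poly.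
  replace (power_moment (S m) k) with (weighted_inner (S m) (fun t => t ^ k) (fun _ => 1))
    by (apply RInt_ext; intros; eqR; ring).
  replace (power_moment m (S (S k))) with (weighted_inner m (fun t => t ^ S k) (fun t => t))
    by (apply RInt_ext; intros; eqR; simpl; ring).
  rewrite S_INR in Green; lra.
Qed.

Lemma RInt_pow k : RInt (fun t => t ^ k) (-1) 1 = (1 - (-1) ^ S k) / (INR k + 1).
Proof.
  pose proof (pos_INR k).
  rewrite (RInt_ext _ (Derive (fun t => / (INR k + 1) * t ^ S k))).
  - rewrite RInt_Derive_polynomial, pow1 by auto with poly; eqR; field; lra.
  - intros t _; rewrite Derive_scal, Derive_id_pow, S_INR; eqR; simpl pred; field; lra.
Qed.

Lemma power_moment_0 k : power_moment 0 k = (1 - (-1) ^ S k) / (INR k + 1).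
Proof.
  rewrite <- RInt_pow; apply RInt_ext; intros t _; simpl; apply Rmult_1_r.
Qed.

Lemma power_moment_even m i : power_moment m (2 * i) = INR (fact m) / Rpoch (INR i + / 2) (S m).
Proof.
  revert i; induction m as [|m IH]; intros i; pose proof (pos_INR i).
  - rewrite power_moment_0, pow_1_odd, mult_INR; simpl; field; lra.
  - apply Rmult_eq_reg_l with (INR (2 * i) + 1); [|pose proof (pos_INR (2 * i)); lra].
    rewrite power_moment_S; replace (S (S (2 * i))) with (2 * S i)%nat by lia; rewrite IH.
    replace (S (S m)) with (1 + S m)%nat by lia; rewrite Rpoch_add, fact_simpl, !mult_INR.
    replace (INR i + / 2 + INR 1) with (INR (S i) + / 2) by (rewrite S_INR; simpl; ring).
    pose proof (Rpoch_pos (INR (S i) + / 2) (S m)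
      ltac:(pose proof (pos_INR (S i)); lra)) as Hpos.
    set (p := Rpoch (INR (S i) + / 2) (S m)) in *.
    rewrite (S_INR m); simpl; field; repeat split; lra.
Qed.

Lemma power_moment_odd m i : power_moment m (2 * i + 1) = 0.
Proof.
  revert i; induction m as [|m IH]; intros i.
  - rewrite power_moment_0; replace (S (2 * i + 1)) with (2 * S i)%nat by lia.
    rewrite pow_1_even; unfold Rdiv; ring.
  - pose proof (power_moment_S m (2 * i + 1)) as Hrec.
    replace (S (S (2 * i + 1))) with (2 * S i + 1)%nat in Hrec by lia.
    rewrite IH in Hrec; pose proof (pos_INR (2 * i + 1)); nra.
Qed.

Definition gegenbauer_moment (d m k : nat) : R :=
  weighted_inner m (fun t => t ^ k) (gegenbauer d (INR m)).

Lemma gegenbauer_moment_0 m k : gegenbauer_moment 0 m k = power_moment m k.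
Proof.
  apply RInt_ext; intros t _; unfold gegenbauer, gegenbauer_trunc; eqR; simpl; ring.
Qed.

Lemma gegenbauer_moment_S d m k :
  gegenbauer_moment (S d) m k = INR k / (2 * (INR m + 1)) * gegenbauer_moment d (S m) (pred k).
Proof.
  pose proof (pos_INR m) as Hm; pose proof (pos_INR d) as Hd.
  set (E := gegenbauer_eigenvalue (S d) (INR m)).
  assert (HE : E < 0) by (unfold E, gegenbauer_eigenvalue; rewrite S_INR; nra).
  pose proof (weighted_inner_gegenbauer_op m (fun t => t ^ k) (gegenbauer (S d) (INR m))
    ltac:(auto with poly) ltac:(auto with poly)) as Green.
  rewrite (weighted_inner_ext m _ (fun t => 1 * t ^ k) _
    (fun t => E * gegenbauer (S d) (INR m) t)) in Green.
  2:{ intros t; ring. }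
  2:{ intros t; apply gegenbauer_op_gegenbauer; lra. }
  rewrite (weighted_inner_ext (S m) _ (fun t => INR k * t ^ pred k) _
    (fun t => - E / (2 * (INR m + 1)) * gegenbauer d (INR (S m)) t)) in Green.
  2:{ intros t; apply Derive_id_pow. }
  2:{ intros t; rewrite S_INR; apply Derive_gegenbauer; lra. }
  rewrite !weighted_inner_scal in Green by auto with poly.
  unfold gegenbauer_moment; apply Rmult_eq_reg_l with (1 * E); [|lra].
  rewrite Green; field; lra.
Qed.

Lemma gegenbauer_moment_low d m k : (k < d)%nat -> gegenbauer_moment d m k = 0.
Proof.
  revert m k; induction d as [|d IH]; intros m k Hk; [lia|].
  rewrite gegenbauer_moment_S; destruct k as [|k]; [simpl; unfold Rdiv; ring|].
  rewrite IH; [ring|simpl; lia].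
Qed.

Lemma gegenbauer_moment_high d m j :
  gegenbauer_moment d m (d + j) = INR (fact (d + j)) * INR (fact m)
    / (INR (fact j) * 2 ^ d * INR (fact (m + d))) * power_moment (m + d) j.
Proof.
  revert m; induction d as [|d IH]; intros m.
  - rewrite gegenbauer_moment_0, Nat.add_0_r; simpl Nat.add; simpl pow.
    field; split; apply INR_fact_neq_0.
  - rewrite gegenbauer_moment_S; simpl Nat.add; simpl pred; rewrite IH.
    replace (m + S d)%nat with (S m + d)%nat by lia.
    rewrite (fact_simpl (d + j)), (fact_simpl m), !mult_INR.
    pose proof (pos_INR m).
    rewrite (S_INR m); simpl pow; field; repeat split; try apply INR_fact_neq_0; try lra.
    apply pow_nonzero; lra.
Qed.

(* Normalised as it occurs in the integral of the kernel, see
   [weighted_inner_kernel_gegenbauer]. *)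
Definition scaled_moment (d m N : nat) : R :=
  gegenbauer_moment d m N / (INR (fact m) * INR (fact N)).

Lemma scaled_moment_low d m N : (N < d)%nat -> scaled_moment d m N = 0.
Proof.
  intros HN; unfold scaled_moment; rewrite gegenbauer_moment_low by exact HN.
  unfold Rdiv; ring.
Qed.

Lemma scaled_moment_odd d m k : scaled_moment d m (d + (2 * k + 1)) = 0.
Proof.
  unfold scaled_moment; rewrite gegenbauer_moment_high, power_moment_odd; unfold Rdiv; ring.
Qed.

Lemma fact_double k : INR (fact (2 * k)) = 4 ^ k * INR (fact k) * Rpoch (/ 2) k.
Proof.
  induction k as [|k IH]; [simpl; ring|].
  replace (2 * S k)%nat with (S (S (2 * k))) by lia.
  rewrite !fact_simpl, !mult_INR, IH, !S_INR, mult_INR; simpl; field.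
Qed.

Lemma scaled_moment_even d m k :
  scaled_moment d m (d + 2 * k)
  = / (2 ^ (d + 2 * k) * INR (fact k) * Rpoch (/ 2) (m + d + 1 + k)).
Proof.
  unfold scaled_moment; rewrite gegenbauer_moment_high, power_moment_even, fact_double.
  replace (m + d + 1 + k)%nat with (k + S (m + d))%nat by lia.
  rewrite Rpoch_add, pow_add, pow_mult, (Rplus_comm (/ 2)).
  replace (2 ^ 2) with 4 by ring.
  pose proof (pos_INR k).
  assert (0 < Rpoch (/ 2) k) by (apply Rpoch_pos; lra).
  assert (0 < Rpoch (INR k + / 2) (S (m + d))) by (apply Rpoch_pos; lra).
  assert (0 < 2 ^ d) by (apply pow_lt; lra).
  assert (0 < 4 ^ k) by (apply pow_lt; lra).
  field; repeat split; try apply INR_fact_neq_0; lra.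
Qed.

(** * The polynomial kernel *)

Definition weighted_pow (j k : nat) (t : R) : R := t ^ j * (1 - t ^ 2) ^ k.

Lemma polynomial_weighted_pow j k : polynomial (weighted_pow j k).
Proof. unfold weighted_pow; auto 10 with poly. Qed.

#[local] Hint Resolve polynomial_weighted_pow : poly.

Lemma weighted_pow_SS j k t :
  weighted_pow (S (S j)) k t + weighted_pow j (S k) t = weighted_pow j k t.
Proof. unfold weighted_pow; simpl; ring. Qed.

Lemma Derive_weighted_pow j k t :
  Derive (weighted_pow j k) t
  = INR j * weighted_pow (pred j) k t + - (2 * INR k) * weighted_pow (S j) (pred k) t.
Proof.
  apply is_derive_unique; unfold weighted_pow; auto_derive; auto.
  replace (1 + - (t * (t * 1))) with (1 - t ^ 2) by ring; simpl; ring.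
Qed.

Lemma gegenbauer_op_weighted_pow mu j k t :
  gegenbauer_op mu (weighted_pow j k) t
  = INR j * (INR j - 1) * weighted_pow (j - 2) k t
    + 4 * INR k * (INR k + mu) * weighted_pow j (pred k) t
    - (INR j + 2 * INR k) * (INR j + 2 * INR k + 2 * mu + 1) * weighted_pow j k t.
Proof.
  unfold gegenbauer_op.
  rewrite (Derive_ext (Derive _) _ t (Derive_weighted_pow j k)).
  rewrite Derive_lincomb, !Derive_weighted_pow by auto with poly.
  unfold weighted_pow; destruct j as [|[|j]]; destruct k as [|[|k]];
    simpl pred; simpl Nat.sub; rewrite ?Nat.sub_0_r, ?S_INR; simpl pow; simpl INR; ring.
Qed.

(* [kernel_form m N N p q] is what multiplies [(a)_N x^(-N)] when the hypergeometric
   series of a Legendre function at [(x - p) / q] is expanded in powers of [1 / x].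
   The test discards the indices at which the subtraction [N - 2 * k] truncates. *)
Definition kernel_coef (m N k : nat) : R :=
  if (2 * k <=? N)%nat
  then / (4 ^ k * INR (fact k) * INR (fact (m + k)) * INR (fact (N - 2 * k)))
  else 0.

Definition kernel_form (m N K : nat) (p q : R) : R :=
  sum_f_R0 (fun k => kernel_coef m N k * p ^ (N - 2 * k) * q ^ (2 * k)) K.

Definition kernel (m N : nat) (t s : R) : R :=
  sum_f_R0 (fun k => kernel_coef m N k * weighted_pow (N - 2 * k) k s
                     * weighted_pow (N - 2 * k) k t) N.

Lemma kernel_coef_high m N k : (N < 2 * k)%nat -> kernel_coef m N k = 0.
Proof. intros Hk; unfold kernel_coef; destruct (Nat.leb_spec (2 * k) N); [lia|reflexivity]. Qed.

Lemma kernel_coef_nonneg m N k : 0 <= kernel_coef m N k.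
Proof.
  unfold kernel_coef; destruct (_ <=? _)%nat; [|lra].
  apply Rlt_le, Rinv_0_lt_compat.
  repeat apply Rmult_lt_0_compat; try apply INR_fact_lt_0; apply pow_lt; lra.
Qed.

Lemma kernel_coef_S m N k :
  4 * INR (S k) * (INR (S k) + INR m) * kernel_coef m N (S k)
  = INR (N - 2 * k) * (INR (N - 2 * k) - 1) * kernel_coef m N k.
Proof.
  destruct (Nat.leb_spec (2 * S k) N) as [Hle|Hgt].
  - unfold kernel_coef; rewrite !(proj2 (Nat.leb_le _ _)) by lia.
    replace (N - 2 * k)%nat with (S (S (N - 2 * S k))) by lia.
    replace (m + S k)%nat with (S (m + k)) by lia.
    rewrite !fact_simpl, !mult_INR, !S_INR, plus_INR.
    pose proof (pos_INR k); pose proof (pos_INR m); pose proof (pos_INR (N - 2 * S k)).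
    simpl pow; field; repeat split; try apply INR_fact_neq_0; try lra.
    apply pow_nonzero; lra.
  - rewrite (kernel_coef_high _ _ (S k)) by lia.
    assert (Hj : (N - 2 * k = 0 \/ N - 2 * k = 1)%nat) by lia.
    destruct Hj as [-> | ->]; simpl; ring.
Qed.

Lemma kernel_sym m N t s : kernel m N t s = kernel m N s t.
Proof. apply sum_eq; intros k _; ring. Qed.

Lemma polynomial_kernel m N s : polynomial (fun t => kernel m N t s).
Proof. unfold kernel; auto 10 with poly. Qed.

Lemma kernel_at_1 m N t : kernel m N t 1 = t ^ N / (INR (fact m) * INR (fact N)).
Proof.
  unfold kernel.
  assert (Hsum : forall K, sum_f_R0 (fun k => kernel_coef m N k * weighted_pow (N - 2 * k) k 1
      * weighted_pow (N - 2 * k) k t) K = t ^ N / (INR (fact m) * INR (fact N))).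
  { induction K as [|K IH].
    - unfold kernel_coef, weighted_pow; simpl; rewrite Nat.add_0_r, Nat.sub_0_r, pow1.
      field; split; apply INR_fact_neq_0.
    - rewrite tech5, IH; unfold weighted_pow at 1; simpl pow; ring. }
  apply Hsum.
Qed.

(* Summation by parts: the lowered terms at [k] and [k + 1] combine. *)
Lemma sum_kernel_coef_shift m N K (a b : nat -> R) :
  sum_f_R0 (fun k => kernel_coef m N k * a k
    * (INR (N - 2 * k) * (INR (N - 2 * k) - 1) * b k
       + 4 * INR k * (INR k + INR m) * b (pred k))) K
  = sum_f_R0 (fun k => INR (N - 2 * k) * (INR (N - 2 * k) - 1) * kernel_coef m N k
      * (a k + a (S k)) * b k) K
    - INR (N - 2 * K) * (INR (N - 2 * K) - 1) * kernel_coef m N K * a (S K) * b K.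
Proof.
  induction K as [|K IH]; [simpl; ring|].
  rewrite !tech5, IH; simpl pred; rewrite <- (kernel_coef_S m N K); ring.
Qed.

(* The right-hand side is symmetric in [t] and [s]. *)
Lemma gegenbauer_op_kernel m N t s :
  gegenbauer_op (INR m) (fun t => kernel m N t s) t
  = sum_f_R0 (fun k => INR (N - 2 * k) * (INR (N - 2 * k) - 1) * kernel_coef m N k
      * weighted_pow (N - 2 - 2 * k) k t * weighted_pow (N - 2 - 2 * k) k s) N
    - INR N * (INR N + 2 * INR m + 1) * kernel m N t s.
Proof.
  unfold kernel; rewrite gegenbauer_op_sum by auto with poly.
  set (low := fun k => weighted_pow (N - 2 - 2 * k) k t).
  rewrite (sum_eq _ (fun k =>
      kernel_coef m N k * weighted_pow (N - 2 * k) k s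
        * (INR (N - 2 * k) * (INR (N - 2 * k) - 1) * low k
           + 4 * INR k * (INR k + INR m) * low (pred k))
      - kernel_coef m N k * weighted_pow (N - 2 * k) k s * weighted_pow (N - 2 * k) k t
        * (INR N * (INR N + 2 * INR m + 1)))).
  - rewrite minus_sum, (sum_kernel_coef_shift m N N (fun k => weighted_pow (N - 2 * k) k s)).
    replace (INR (N - 2 * N)) with 0 by (replace (N - 2 * N)%nat with O by lia; reflexivity).
    rewrite <- (scal_sum (fun k => kernel_coef m N k * weighted_pow (N - 2 * k) k s
      * weighted_pow (N - 2 * k) k t)).
    rewrite (sum_eq _ (fun k => INR (N - 2 * k) * (INR (N - 2 * k) - 1) * kernel_coef m N k
      * low k * weighted_pow (N - 2 - 2 * k) k s)); [unfold low; ring|].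
    intros k _; rewrite <- kernel_coef_S.
    destruct (Nat.leb_spec (2 * S k) N) as [Hle|Hgt]; [|rewrite kernel_coef_high by lia; ring].
    rewrite <- (weighted_pow_SS (N - 2 - 2 * k) k s).
    replace (N - 2 * k)%nat with (S (S (N - 2 - 2 * k))) by lia.
    replace (N - 2 * S k)%nat with (N - 2 - 2 * k)%nat by lia; ring.
  - intros k _; rewrite gegenbauer_op_weighted_pow.
    destruct (Nat.leb_spec (2 * k) N) as [Hle|Hgt]; [|rewrite kernel_coef_high by lia; ring].
    replace (INR N) with (INR (N - 2 * k) + 2 * INR k)
      by (rewrite minus_INR, mult_INR by lia; simpl; ring).
    replace (N - 2 * k - 2)%nat with (N - 2 - 2 * k)%nat by lia; unfold low.
    destruct k as [|k]; [simpl; ring|].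
    simpl pred; replace (N - 2 - 2 * k)%nat with (N - 2 * S k)%nat by lia; ring.
Qed.

Lemma gegenbauer_op_kernel_comm m N t s :
  gegenbauer_op (INR m) (fun t => kernel m N t s) t
  = gegenbauer_op (INR m) (fun s => kernel m N t s) s.
Proof.
  rewrite (gegenbauer_op_ext _ _ _ s (fun u => kernel_sym m N t u)), !gegenbauer_op_kernel.
  rewrite kernel_sym; f_equal; apply sum_eq; intros; ring.
Qed.

Lemma weighted_inner_kernel m N g s : polynomial g ->
  weighted_inner m (fun t => kernel m N t s) g
  = sum_f_R0 (fun k => kernel_coef m N k * weighted_inner m (weighted_pow (N - 2 * k) k) g
                       * weighted_pow (N - 2 * k) k s) N.
Proof.
  intros Hg; unfold kernel; rewrite (weighted_inner_sum m _ (fun k => weighted_pow (N - 2 * k) k))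
    by auto with poly.
  apply sum_eq; intros; ring.
Qed.

Lemma gegenbauer_op_weighted_inner_kernel m N g s : polynomial g ->
  gegenbauer_op (INR m) (fun s => weighted_inner m (fun t => kernel m N t s) g) s
  = weighted_inner m (fun t => kernel m N t s) (gegenbauer_op (INR m) g).
Proof.
  intros Hg; rewrite <- gegenbauer_op_selfadjoint by auto using polynomial_kernel.
  rewrite (gegenbauer_op_ext _ _ _ s (fun u => weighted_inner_kernel m N g u Hg)).
  rewrite (gegenbauer_op_sum _ _ (fun k => weighted_pow (N - 2 * k) k)) by auto with poly.
  rewrite (weighted_inner_ext m _ (fun t => sum_f_R0 (fun k => kernel_coef m N k
    * gegenbauer_op (INR m) (weighted_pow (N - 2 * k) k) s * weighted_pow (N - 2 * k) k t) N) g g);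
    [|intros t|reflexivity].
  - rewrite (weighted_inner_sum m _ (fun k => weighted_pow (N - 2 * k) k)) by auto with poly.
    apply sum_eq; intros; ring.
  - rewrite gegenbauer_op_kernel_comm, (gegenbauer_op_ext _ _ _ s (kernel_sym m N t)).
    unfold kernel; rewrite (gegenbauer_op_sum _ _ (fun k => weighted_pow (N - 2 * k) k))
      by auto with poly.
    apply sum_eq; intros; ring.
Qed.

Lemma weighted_inner_kernel_gegenbauer d m N s :
  weighted_inner m (fun t => kernel m N t s) (gegenbauer d (INR m))
  = scaled_moment d m N * gegenbauer d (INR m) s.
Proof.
  set (Y := gegenbauer d (INR m)); pose proof (pos_INR m) as Hm.
  assert (HY : polynomial Y) by (unfold Y; auto with poly).
  set (F := fun s => weighted_inner m (fun t => kernel m N t s) Y); fold (F s).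
  rewrite (gegenbauer_op_eigen_unique d (INR m) F); [|lra| |].
  - fold Y; f_equal; unfold F, scaled_moment, gegenbauer_moment; fold Y.
    rewrite (weighted_inner_ext m _ (fun t => / (INR (fact m) * INR (fact N)) * t ^ N) _
      (fun t => 1 * Y t)).
    + rewrite weighted_inner_scal by auto with poly; unfold Rdiv; ring.
    + intros t; rewrite kernel_at_1; unfold Rdiv; ring.
    + intros t; ring.
  - apply (polynomial_ext _ _ (fun u => eq_sym (weighted_inner_kernel m N Y u HY))).
    auto with poly.
  - intros u; unfold F; rewrite gegenbauer_op_weighted_inner_kernel by exact HY.
    rewrite (weighted_inner_ext m _ (fun t => 1 * kernel m N t u) _
      (fun t => gegenbauer_eigenvalue d (INR m) * Y t)).
    + rewrite weighted_inner_scal by auto using polynomial_kernel; ring.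
    + intros t; ring.
    + intros t; apply gegenbauer_op_gegenbauer; lra.
Qed.

Lemma fact_double_le k : INR (fact (2 * k)) <= 4 ^ k * INR (fact k) * INR (fact k).
Proof.
  rewrite fact_double; apply Rmult_le_compat_l.
  - apply Rmult_le_pos; [apply pow_le; lra|apply pos_INR].
  - induction k as [|k IH]; [simpl; lra|].
    rewrite fact_simpl, mult_INR, S_INR; simpl Rpoch.
    pose proof (pos_INR k); pose proof (Rpoch_pos (/ 2) k ltac:(lra)).
    rewrite (Rmult_comm (INR k + 1)); apply Rmult_le_compat; lra.
Qed.

Lemma kernel_coef_le m N k : (2 * k <= N)%nat ->
  kernel_coef m N k <= / (INR (fact (2 * k)) * INR (fact (N - 2 * k))).
Proof.
  intros Hk; unfold kernel_coef; rewrite (proj2 (Nat.leb_le _ _)) by exact Hk.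
  apply Rinv_le_contravar.
  - apply Rmult_lt_0_compat; apply INR_fact_lt_0.
  - apply Rmult_le_compat_r; [apply pos_INR|].
    eapply Rle_trans; [apply fact_double_le|].
    apply Rmult_le_compat_l; [|apply le_INR, fact_le; lia].
    apply Rmult_le_pos; [apply pow_le; lra|apply pos_INR].
Qed.

Lemma sum_even_le (f : nat -> R) K : (forall i, 0 <= f i) ->
  sum_f_R0 (fun k => f (2 * k)%nat) K <= sum_f_R0 f (2 * K).
Proof.
  intros Hf; induction K as [|K IH]; [simpl; lra|].
  rewrite tech5; replace (2 * S K)%nat with (S (S (2 * K))) by lia.
  rewrite !tech5; pose proof (Hf (S (2 * K))); lra.
Qed.

(* The terms of [kernel_form] are dominated by the even terms of the binomial
   expansion of [(p + q)^N / N!]. *)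
Lemma kernel_form_le m N K p q : 0 <= p -> 0 <= q ->
  kernel_form m N K p q <= (p + q) ^ N / INR (fact N).
Proof.
  intros Hp Hq.
  set (f := fun i => if (i <=? N)%nat
    then p ^ (N - i) * q ^ i / (INR (fact i) * INR (fact (N - i))) else 0).
  assert (Hf : forall i, 0 <= f i).
  { intros i; unfold f; destruct (_ <=? _)%nat; [|lra].
    apply Rmult_le_pos; [apply Rmult_le_pos; apply pow_le; auto|].
    apply Rlt_le, Rinv_0_lt_compat, Rmult_lt_0_compat; apply INR_fact_lt_0. }
  apply Rle_trans with (sum_f_R0 (fun k => f (2 * k)%nat) K).
  - apply sum_Rle; intros k _; unfold f.
    destruct (Nat.leb_spec (2 * k) N) as [Hk|Hk]; [|rewrite kernel_coef_high by exact Hk; lra].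
    rewrite Rmult_assoc, Rmult_comm; apply Rmult_le_compat_l; [|apply kernel_coef_le, Hk].
    apply Rmult_le_pos; apply pow_le; auto.
  - eapply Rle_trans; [apply sum_even_le, Hf|].
    replace ((p + q) ^ N / INR (fact N)) with (sum_f_R0 f N).
    + rewrite <- !sum_n_Reals; apply sum_n_le_series; [exact Hf|].
      apply (is_series_finite (V := R_NormedModule)); intros i Hi; unfold f.
      destruct (Nat.leb_spec i N); [lia|reflexivity].
    + rewrite Rplus_comm, binomial; unfold Rdiv; rewrite Rmult_comm, scal_sum.
      apply sum_eq; intros i Hi; unfold f, Binomial.C.
      rewrite (proj2 (Nat.leb_le _ _)) by exact Hi.
      field; repeat split; apply INR_fact_neq_0.
Qed.

Lemma Rabs_kernel_form_le m N K p q : Rabs p + Rabs q <= 1 ->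
  Rabs (kernel_form m N K p q) <= / INR (fact N).
Proof.
  intros Hpq; apply Rle_trans with (kernel_form m N K (Rabs p) (Rabs q)).
  - eapply Rle_trans; [apply Rsum_abs|]; apply sum_Rle; intros k _; apply Req_le.
    rewrite !Rabs_mult, <- !RPow_abs, (Rabs_right (kernel_coef _ _ _)); [reflexivity|].
    apply Rle_ge, kernel_coef_nonneg.
  - pose proof (Rabs_pos p); pose proof (Rabs_pos q).
    eapply Rle_trans; [apply kernel_form_le; auto|].
    rewrite <- (Rmult_1_l (/ _)); apply Rmult_le_compat_r.
    + apply Rlt_le, Rinv_0_lt_compat, INR_fact_lt_0.
    + rewrite <- (pow1 N); apply pow_incr; lra.
Qed.

Lemma sin_sqr th : sin th ^ 2 = 1 - cos th ^ 2.
Proof. pose proof (sin2_cos2 th) as Hsc; unfold Rsqr in Hsc; simpl; lra. Qed.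

Lemma kernel_cos m N a b :
  kernel m N (cos a) (cos b) = kernel_form m N N (cos a * cos b) (sin a * sin b).
Proof.
  apply sum_eq; intros k _; unfold weighted_pow.
  rewrite <- !sin_sqr, !Rpow_mult_distr, <- !pow_mult; ring.
Qed.

Lemma Rabs_cos_sin_le a b : Rabs (cos a * cos b) + Rabs (sin a * sin b) <= 1.
Proof.
  pose proof (COS_bound (a - b)); pose proof (COS_bound (a + b)).
  rewrite cos_minus in *; rewrite cos_plus in *.
  unfold Rabs; destruct (Rcase_abs _); destruct (Rcase_abs _); lra.
Qed.

Lemma Rabs_kernel_le m N a b : Rabs (kernel m N (cos a) (cos b)) <= / INR (fact N).
Proof. rewrite kernel_cos; apply Rabs_kernel_form_le, Rabs_cos_sin_le. Qed.

Lemma is_RInt_cos_sin f : polynomial f ->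
  is_RInt (fun th => f (cos th) * sin th) 0 PI (RInt f (-1) 1).
Proof.
  intros Hf.
  replace (RInt f (-1) 1) with (opp (RInt f (cos 0) (cos PI))).
  2:{ rewrite cos_0, cos_PI; apply (opp_RInt_swap (V := R_CompleteNormedModule)).
      apply polynomial_ex_RInt, Hf. }
  apply (is_RInt_ext (fun th => opp (scal (- sin th) (f (cos th))))).
  { intros th _; unfold opp, scal; simpl; unfold mult; simpl; eqR; ring. }
  apply @is_RInt_opp.
  apply (is_RInt_comp (V := R_CompleteNormedModule) f cos (fun th => - sin th)).
  - intros th _; apply polynomial_continuous, Hf.
  - intros th _; split; [auto_derive; auto; ring|].
    apply (ex_derive_continuous (K := R_AbsRing) (V := R_NormedModule)).
    auto_derive; auto.
Qed.

Lemma is_RInt_kernel_gegenbauer d m N th' :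
  is_RInt (fun th => kernel m N (cos th) (cos th')
      * (sin th ^ (2 * m + 1) * gegenbauer d (INR m) (cos th))) 0 PI
    (scaled_moment d m N * gegenbauer d (INR m) (cos th')).
Proof.
  rewrite <- weighted_inner_kernel_gegenbauer.
  eapply is_RInt_ext; [|apply is_RInt_cos_sin; auto 10 using polynomial_kernel with poly].
  intros th _; cbv beta; rewrite <- sin_sqr, <- pow_mult, pow_add; eqR; simpl; ring.
Qed.

(** * Complex sequences, series and derivatives *)

Notation is_Clim_seq u l := (filterlim u eventually (locally (T := C_UniformSpace) l)).
Notation Csum_n := (sum_n (G := C_NormedModule)).
Notation is_Cseries := (is_series (V := C_NormedModule)).

Lemma Ceq (z w : C) : Re z = Re w -> Im z = Im w -> z = w.
Proof. destruct z, w; simpl; intros; f_equal; auto. Qed.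

Lemma RtoC_neq_0 x : x <> 0 -> RtoC x <> RtoC 0.
Proof. intros Hx E; apply RtoC_inj in E; auto. Qed.

Lemma RtoC_fact_neq_0 n : RtoC (INR (fact n)) <> RtoC 0.
Proof. apply RtoC_neq_0, INR_fact_neq_0. Qed.

Lemma Im_le_Cmod (c : C) : Rabs (Im c) <= Cmod c.
Proof. eapply Rle_trans; [apply Rmax_r|apply Rmax_Cmod]. Qed.

Lemma is_Clim_seq_iff (u : nat -> C) (l : C) :
  is_Clim_seq u l <->
  is_lim_seq (fun n => Re (u n)) (Re l) /\ is_lim_seq (fun n => Im (u n)) (Im l).
Proof.
  split.
  - intros H; split.
    + apply (filterlim_comp _ _ _ u fst _ _ _ H).
      intros P [e He]; exists e; intros [x y] [Hx _]; apply He, Hx.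
    + apply (filterlim_comp _ _ _ u snd _ _ _ H).
      intros P [e He]; exists e; intros [x y] [_ Hy]; apply He, Hy.
  - intros [HRe HIm] P [e He].
    apply is_lim_seq_spec in HRe; destruct (HRe e) as [NRe Hre].
    apply is_lim_seq_spec in HIm; destruct (HIm e) as [NIm Him].
    exists (NRe + NIm)%nat; intros n Hn; apply He.
    split; [apply Hre|apply Him]; lia.
Qed.

Lemma is_Clim_seq_RtoC (u : nat -> R) (l : R) :
  is_lim_seq u l -> is_Clim_seq (fun n => RtoC (u n)) (RtoC l).
Proof. intros Hu; apply is_Clim_seq_iff; split; [exact Hu|apply is_lim_seq_const]. Qed.

Lemma is_Clim_seq_plus (u v : nat -> C) (a b : C) :
  is_Clim_seq u a -> is_Clim_seq v b -> is_Clim_seq (fun n => u n + v n)%C (a + b)%C.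
Proof. exact (filterlim_plus_fun (V := C_NormedModule) u v a b). Qed.

Lemma is_Clim_seq_mult (u v : nat -> C) (a b : C) :
  is_Clim_seq u a -> is_Clim_seq v b -> is_Clim_seq (fun n => u n * v n)%C (a * b)%C.
Proof.
  intros Hu Hv; apply is_Clim_seq_iff in Hu; apply is_Clim_seq_iff in Hv.
  destruct Hu as [uRe uIm]; destruct Hv as [vRe vIm].
  apply is_Clim_seq_iff; split; simpl.
  - apply is_lim_seq_minus'; apply is_lim_seq_mult'; auto.
  - apply is_lim_seq_plus'; apply is_lim_seq_mult'; auto.
Qed.

Lemma Clim_seq_unique (u : nat -> C) (l : C) : is_Clim_seq u l -> Clim_seq u = l.
Proof. exact (iota_filterlim_locally (V := C_CompleteNormedModule) (F := eventually) u l). Qed.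

Lemma Cseries_unique (u : nat -> C) (l : C) : is_Cseries u l -> Cseries u = l.
Proof.
  exact (iota_filterlim_locally (V := C_CompleteNormedModule) (F := eventually) (Csum_n u) l).
Qed.

Lemma Cseries_correct (u : nat -> C) (l : C) : is_Cseries u l -> is_Cseries u (Cseries u).
Proof. intros Hu; rewrite (Cseries_unique u l Hu); exact Hu. Qed.

Lemma is_Cseries_unique (u : nat -> C) (l l' : C) : is_Cseries u l -> is_Cseries u l' -> l = l'.
Proof.
  intros Hl Hl'; rewrite <- (Cseries_unique u l Hl); apply Cseries_unique, Hl'.
Qed.

Lemma is_Cseries_scal (c : C) (u v : nat -> C) (l : C) :
  (forall n, v n = c * u n)%C -> is_Cseries u l -> is_Cseries v (c * l)%C.
Proof.
  intros Hv Hu; apply (is_series_ext (V := C_NormedModule) (fun n => c * u n)%C).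
  - intros n; symmetry; apply Hv.
  - exact (is_series_scal (V := C_NormedModule) c u l Hu).
Qed.

Lemma Csum_n_RtoC (c : C) (u : nat -> R) n :
  Csum_n (fun k => c * RtoC (u k))%C n = (c * RtoC (sum_f_R0 u n))%C.
Proof.
  induction n as [|n IH]; [rewrite sum_O; reflexivity|].
  rewrite sum_Sn, IH, tech5, RtoC_plus; unfold plus; simpl; ring.
Qed.

Lemma is_Cseries_iff (u : nat -> C) (l : C) :
  is_Cseries u l <->
  is_series (fun n => Re (u n)) (Re l) /\ is_series (fun n => Im (u n)) (Im l).
Proof.
  assert (HRe : forall n, sum_n (fun k => Re (u k)) n = Re (Csum_n u n)).
  { induction n as [|n IH]; [rewrite !sum_O; reflexivity|rewrite !sum_Sn, IH; reflexivity]. }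
  assert (HIm : forall n, sum_n (fun k => Im (u k)) n = Im (Csum_n u n)).
  { induction n as [|n IH]; [rewrite !sum_O; reflexivity|rewrite !sum_Sn, IH; reflexivity]. }
  unfold is_series at 1; rewrite is_Clim_seq_iff; split; intros [Hre Him]; split.
  - exact (is_lim_seq_ext _ _ _ (fun n => eq_sym (HRe n)) Hre).
  - exact (is_lim_seq_ext _ _ _ (fun n => eq_sym (HIm n)) Him).
  - exact (is_lim_seq_ext _ _ (Re l) HRe Hre).
  - exact (is_lim_seq_ext _ _ (Im l) HIm Him).
Qed.

Definition is_Cderive (f : R -> C) (t : R) (l : C) : Prop :=
  is_derive (fun u => Re (f u)) t (Re l) /\ is_derive (fun u => Im (f u)) t (Im l).

Lemma is_Cderive_mult f g t (f' g' : C) : is_Cderive f t f' -> is_Cderive g t g' ->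
  is_Cderive (fun u => f u * g u)%C t (f' * g t + f t * g')%C.
Proof.
  intros [fRe fIm] [gRe gIm]; split; simpl.
  - evar_last; [apply @is_derive_minus; apply @is_derive_mult; eauto; intros; apply Rmult_comm|].
    unfold minus, plus, opp, mult; simpl; unfold Re, Im; ring.
  - evar_last; [apply @is_derive_plus; apply @is_derive_mult; eauto; intros; apply Rmult_comm|].
    unfold plus, mult; simpl; unfold Re, Im; ring.
Qed.

Lemma is_Cderive_zero_const f a b :
  (forall t, Rmin a b <= t <= Rmax a b -> is_Cderive f t 0) -> f a = f b.
Proof.
  assert (Hlt : forall x y, x < y -> (forall t, x <= t <= y -> is_Cderive f t 0) -> f x = f y).
  { intros x y Hxy Hf; apply Ceq; [apply (eq_is_derive (fun u => Re (f u)))|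
      apply (eq_is_derive (fun u => Im (f u)))]; auto; intros t Ht; apply Hf, Ht. }
  intros Hf; destruct (Rtotal_order a b) as [Hab|[Hab|Hab]].
  - apply Hlt; [exact Hab|]; rewrite Rmin_left, Rmax_right in Hf by lra; exact Hf.
  - rewrite Hab; reflexivity.
  - symmetry; apply Hlt; [exact Hab|]; rewrite Rmin_right, Rmax_left in Hf by lra; exact Hf.
Qed.

Lemma CV_radius_le (a b : nat -> R) : (forall n, Rabs (a n) <= b n) ->
  Rbar_le (CV_radius b) (CV_radius a).
Proof.
  intros Hab; apply (proj2 (CV_radius_bounded b)); intros r [M HM].
  apply (proj1 (CV_radius_bounded a)); exists M; intros n.
  eapply Rle_trans; [|apply HM]; rewrite !Rabs_mult.
  apply Rmult_le_compat_r; [apply Rabs_pos|].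
  eapply Rle_trans; [apply Hab|apply Rle_abs].
Qed.

Definition CPSeries (c : nat -> C) (y : R) : C :=
  (PSeries (fun n => Re (c n)) y, PSeries (fun n => Im (c n)) y).

Section ComplexPowerSeries.

Variables (c : nat -> C) (y : R).
Hypothesis Hy : Rbar_lt (Rabs y) (CV_radius (fun n => Cmod (c n))).

Lemma CPSeries_Re_inside : Rbar_lt (Rabs y) (CV_radius (fun n => Re (c n))).
Proof. apply (Rbar_lt_le_trans _ _ _ Hy), CV_radius_le; intros n; apply re_le_Cmod. Qed.

Lemma CPSeries_Im_inside : Rbar_lt (Rabs y) (CV_radius (fun n => Im (c n))).
Proof. apply (Rbar_lt_le_trans _ _ _ Hy), CV_radius_le; intros n; apply Im_le_Cmod. Qed.

Lemma CPSeries_correct : is_Cseries (fun n => c n * RtoC (y ^ n))%C (CPSeries c y).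
Proof.
  apply is_Cseries_iff; split.
  - apply (is_series_ext (fun n => Re (c n) * y ^ n)); [intros n; symmetry; apply re_scal_r|].
    apply is_pseries_R, PSeries_correct, CV_radius_inside, CPSeries_Re_inside.
  - apply (is_series_ext (fun n => Im (c n) * y ^ n)); [intros n; symmetry; apply im_scal_r|].
    apply is_pseries_R, PSeries_correct, CV_radius_inside, CPSeries_Im_inside.
Qed.

End ComplexPowerSeries.

Definition CPS_derive (c : nat -> C) (n : nat) : C := (RtoC (INR (S n)) * c (S n))%C.

Lemma CV_radius_CPS_derive c :
  CV_radius (fun n => Cmod (CPS_derive c n)) = CV_radius (fun n => Cmod (c n)).
Proof.
  rewrite <- (CV_radius_derive (fun n => Cmod (c n))); apply CV_radius_ext; intros n.
  unfold CPS_derive, PS_derive; rewrite Cmod_mult, Cmod_R, Rabs_right; [reflexivity|].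
  apply Rle_ge, pos_INR.
Qed.

Lemma is_Cderive_CPSeries c y : Rbar_lt (Rabs y) (CV_radius (fun n => Cmod (c n))) ->
  is_Cderive (CPSeries c) y (CPSeries (CPS_derive c) y).
Proof.
  intros Hy; split; simpl.
  - rewrite (PSeries_ext _ (PS_derive (fun n => Re (c n)))).
    + apply is_derive_PSeries, CPSeries_Re_inside, Hy.
    + intros n; apply re_scal_l.
  - rewrite (PSeries_ext _ (PS_derive (fun n => Im (c n)))).
    + apply is_derive_PSeries, CPSeries_Im_inside, Hy.
    + intros n; apply im_scal_l.
Qed.

(** * Complex powers and the binomial series *)

Lemma Cexp_plus (z w : C) : Cexp (z + w) = (Cexp z * Cexp w)%C.
Proof.
  destruct z, w; unfold Cexp; apply Ceq; simpl;
    rewrite exp_plus, ?cos_plus, ?sin_plus; ring.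
Qed.

Lemma Cexp_RtoC x : Cexp (RtoC x) = RtoC (exp x).
Proof. unfold Cexp; apply Ceq; simpl; rewrite ?cos_0, ?sin_0; ring. Qed.

Lemma Cexp_RtoC_Ci x : Cexp (RtoC x * Ci) = (cos x, sin x).
Proof.
  unfold Cexp; apply Ceq; simpl;
    rewrite !Rmult_0_l, !Rmult_0_r, Rmult_1_r, Rminus_diag, Rplus_0_r, exp_0; ring.
Qed.

Lemma Cexp_0 : Cexp 0 = RtoC 1.
Proof. rewrite Cexp_RtoC, exp_0; reflexivity. Qed.

Lemma Cexp_neq_0 (z : C) : Cexp z <> RtoC 0.
Proof.
  intros Hz; apply C1_nz; rewrite <- Cexp_0, <- (Cplus_opp_r z), Cexp_plus, Hz; ring.
Qed.

Lemma Crpow_plus x a b : Crpow x (a + b) = (Crpow x a * Crpow x b)%C.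
Proof. unfold Crpow; rewrite <- Cexp_plus; f_equal; ring. Qed.

Lemma Crpow_0 x : Crpow x 0 = RtoC 1.
Proof. unfold Crpow; rewrite Cmult_0_l; apply Cexp_0. Qed.

Lemma Crpow_1_l a : Crpow 1 a = RtoC 1.
Proof. unfold Crpow; rewrite ln_1, Cmult_0_r; apply Cexp_0. Qed.

Lemma Crpow_neq_0 x a : Crpow x a <> RtoC 0.
Proof. apply Cexp_neq_0. Qed.

Lemma Crpow_opp x a : Crpow x (- a) = (/ Crpow x a)%C.
Proof.
  assert (Hinv : (Crpow x (- a) * Crpow x a)%C = RtoC 1).
  { rewrite <- Crpow_plus, Cplus_comm, Cplus_opp_r; apply Crpow_0. }
  pose proof (Crpow_neq_0 x a) as Hnz.
  rewrite <- (Cmult_1_l (/ Crpow x a)), <- Hinv; field; exact Hnz.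
Qed.

Lemma Crpow_mult x y a : 0 < x -> 0 < y ->
  Crpow (x * y) a = (Crpow x a * Crpow y a)%C.
Proof.
  intros; unfold Crpow; rewrite <- Cexp_plus, ln_mult, RtoC_plus by auto.
  f_equal; ring.
Qed.

Lemma Crpow_inv x a : 0 < x -> Crpow (/ x) a = (/ Crpow x a)%C.
Proof.
  intros; rewrite <- Crpow_opp; unfold Crpow; rewrite ln_Rinv, RtoC_opp by auto; f_equal; ring.
Qed.

Lemma Crpow_div x y a : 0 < x -> 0 < y ->
  Crpow (x / y) a = (Crpow x a / Crpow y a)%C.
Proof.
  intros; unfold Rdiv, Cdiv.
  rewrite Crpow_mult, Crpow_inv by auto using Rinv_0_lt_compat; reflexivity.
Qed.

Lemma Crpow_sqr x (w : C) : 0 < x -> Crpow (x ^ 2) (w / 2) = Crpow x w.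
Proof.
  intros Hx; simpl; rewrite Rmult_1_r, Crpow_mult, <- Crpow_plus by auto; f_equal; field.
Qed.

Lemma Crpow_1_r x : 0 < x -> Crpow x 1 = RtoC x.
Proof.
  intros Hx; unfold Crpow; rewrite Cmult_1_l, Cexp_RtoC, exp_ln by auto; reflexivity.
Qed.

Lemma Crpow_nat x n : 0 < x -> Crpow x (RtoC (INR n)) = RtoC (x ^ n).
Proof.
  intros Hx; induction n as [|n IH]; [apply Crpow_0|].
  rewrite S_INR, RtoC_plus, Crpow_plus, IH, Crpow_1_r, <- RtoC_mult by auto.
  simpl; rewrite Rmult_comm; reflexivity.
Qed.

Lemma is_Cderive_Crpow (z : C) t : 0 < t ->
  is_Cderive (fun u => Crpow u z) t (z * RtoC (/ t) * Crpow t z)%C.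
Proof.
  intros Ht; destruct z as [a b]; unfold Crpow, Cexp; split; simpl; auto_derive; auto;
    unfold Rminus; field; lra.
Qed.

Lemma is_Cderive_reflect f t (l : C) : is_Cderive f (1 - t) l ->
  is_Cderive (fun u => f (1 - u)) t (- l)%C.
Proof.
  assert (Hd : is_derive (fun u : R => 1 - u) t (-1)) by (auto_derive; auto; ring).
  intros [fRe fIm]; split.
  - evar_last; [exact (is_derive_comp (fun u => Re (f u)) _ t _ _ fRe Hd)|].
    unfold scal; simpl; unfold mult, Re, Im; simpl; ring.
  - evar_last; [exact (is_derive_comp (fun u => Im (f u)) _ t _ _ fIm Hd)|].
    unfold scal; simpl; unfold mult, Re, Im; simpl; ring.
Qed.

Lemma is_lim_seq_inv_INR : is_lim_seq (fun n => / INR n) 0.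
Proof. apply (is_lim_seq_inv _ p_infty); [apply is_lim_seq_INR|discriminate]. Qed.

Lemma CV_radius_Rpoch A : 0 < A -> CV_radius (fun n => Rpoch A n / INR (fact n)) = Finite 1.
Proof.
  intros HA; rewrite (CV_radius_finite_DAlembert _ 1); [f_equal; apply Rinv_1| |lra|].
  - intros n; apply Rgt_not_eq, Rdiv_lt_0_compat; [apply Rpoch_pos, HA|apply INR_fact_lt_0].
  - apply (is_lim_seq_ext (fun n => 1 + (A - 1) * / INR (S n))).
    + intros n; pose proof (Rpoch_pos A n HA); pose proof (Rpoch_pos A (S n) HA).
      pose proof (INR_fact_lt_0 n); pose proof (INR_fact_lt_0 (S n)).
      assert (0 < INR (S n)) by (apply lt_0_INR; lia).
      rewrite Rabs_right by (apply Rle_ge, Rlt_le; repeat apply Rdiv_lt_0_compat; auto).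
      rewrite fact_simpl, mult_INR; simpl Rpoch.
      replace (A + INR n) with (INR (S n) + (A - 1)) by (rewrite S_INR; ring).
      field; repeat split; lra.
    + replace (Finite 1) with (Finite (1 + (A - 1) * 0)) by (f_equal; ring).
      apply is_lim_seq_plus'; [apply is_lim_seq_const|].
      apply is_lim_seq_mult'; [apply is_lim_seq_const|].
      apply (is_lim_seq_incr_1 (fun n => / INR n)), is_lim_seq_inv_INR.
Qed.

Lemma ex_series_Rpoch A y : 0 < A -> 0 <= y < 1 ->
  ex_series (fun n => Rpoch A n / INR (fact n) * y ^ n).
Proof.
  intros HA Hy; apply ex_pseries_R, CV_radius_inside.
  rewrite CV_radius_Rpoch by exact HA; simpl; rewrite Rabs_right; lra.
Qed.

Lemma Cmod_Cpoch_le z n : Cmod (Cpoch z n) <= Rpoch (Cmod z + 1) n.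
Proof.
  induction n as [|n IH]; simpl; [rewrite Cmod_1; lra|].
  rewrite Cmod_mult; apply Rmult_le_compat; try apply Cmod_ge_0; auto.
  eapply Rle_trans; [apply Cmod_triangle|].
  rewrite Cmod_R, Rabs_right by (apply Rle_ge, pos_INR); lra.
Qed.

Definition binomial_coef (z : C) (n : nat) : C := (Cpoch z n / RtoC (INR (fact n)))%C.

Lemma Cmod_binomial_coef_le z n :
  Cmod (binomial_coef z n) <= Rpoch (Cmod z + 1) n / INR (fact n).
Proof.
  unfold binomial_coef, Cdiv.
  rewrite Cmod_mult, Cmod_inv, Cmod_R, Rabs_right
    by (first [apply RtoC_fact_neq_0|apply Rle_ge, pos_INR]).
  apply Rmult_le_compat_r; [|apply Cmod_Cpoch_le].
  left; apply Rinv_0_lt_compat, INR_fact_lt_0.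
Qed.

Lemma binomial_coef_S z n :
  (RtoC (INR (S n)) * binomial_coef z (S n) = (z + RtoC (INR n)) * binomial_coef z n)%C.
Proof.
  unfold binomial_coef; rewrite fact_simpl, mult_INR, RtoC_mult; simpl Cpoch.
  pose proof (RtoC_fact_neq_0 n).
  assert (RtoC (INR (S n)) <> 0) by (apply RtoC_neq_0, not_0_INR; lia).
  field; auto.
Qed.

Lemma CV_radius_binomial_coef z y : Rabs y < 1 ->
  Rbar_lt (Rabs y) (CV_radius (fun n => Cmod (binomial_coef z n))).
Proof.
  intros Hy; apply Rbar_lt_le_trans with (Finite 1); [exact Hy|].
  rewrite <- (CV_radius_Rpoch (Cmod z + 1)) by (pose proof (Cmod_ge_0 z); lra).
  apply CV_radius_le; intros n; rewrite Rabs_right by apply Rle_ge, Cmod_ge_0.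
  apply Cmod_binomial_coef_le.
Qed.

(* The recurrence of the coefficients is the equation [f' = z f + y f']. *)
Lemma CPSeries_binomial_ode (z : C) y : Rabs y < 1 ->
  (RtoC (1 - y) * CPSeries (CPS_derive (binomial_coef z)) y
   = z * CPSeries (binomial_coef z) y)%C.
Proof.
  intros Hy; set (c := binomial_coef z).
  pose proof (CV_radius_binomial_coef z y Hy) as Hrad; fold c in Hrad.
  pose proof (CPSeries_correct c y Hrad) as Hf.
  rewrite <- CV_radius_CPS_derive in Hrad; pose proof (CPSeries_correct _ y Hrad) as Hf'.
  set (f := CPSeries c y) in *; set (f' := CPSeries (CPS_derive c) y) in *.
  assert (Hyf' : is_Cseries (fun n => RtoC (INR n) * c n * RtoC (y ^ n))%C (RtoC y * f')%C).
  { apply (is_series_shift (V := C_NormedModule) _ 1).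
    - intros [|k] Hk; [simpl; unfold zero; simpl; ring|lia].
    - apply (is_Cseries_scal (RtoC y) (fun n => CPS_derive c n * RtoC (y ^ n))%C); [|exact Hf'].
      intros n; unfold CPS_derive; cbn [Nat.add pow]; rewrite RtoC_mult; ring. }
  assert (Heq : f' = (z * f + RtoC y * f')%C).
  { apply (is_Cseries_unique _ _ _ Hf').
    pose proof (is_Cseries_scal z _ _ _ (fun n => eq_refl) Hf) as Hzf.
    eapply (is_series_ext (V := C_NormedModule)); [|exact (is_series_plus _ _ _ _ Hzf Hyf')].
    intros n; unfold CPS_derive, c; rewrite binomial_coef_S; unfold plus; simpl; ring. }
  rewrite RtoC_minus; transitivity (f' - RtoC y * f')%C; [ring|rewrite Heq at 1; ring].
Qed.

(* [(1 - t)^z f(t)] is constant, where [f] is the sum of the series. *)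
Lemma binomial_series (z : C) y : Rabs y < 1 ->
  is_Cseries (fun n => binomial_coef z n * RtoC (y ^ n))%C (Crpow (1 - y) (- z)).
Proof.
  intros Hy; set (f := CPSeries (binomial_coef z)).
  assert (Hconst : (Crpow (1 - y) z * f y = Crpow (1 - 0) z * f 0)%C).
  { apply (is_Cderive_zero_const (fun t => Crpow (1 - t) z * f t)%C); intros t Ht.
    assert (Ht1 : Rabs t < 1).
    { apply Rabs_def2 in Hy; apply Rabs_def1;
        unfold Rmin, Rmax in Ht; destruct (Rle_dec y 0); lra. }
    assert (H1t : 0 < 1 - t) by (apply Rabs_def2 in Ht1; lra).
    pose proof (is_Cderive_reflect _ _ _ (is_Cderive_Crpow z (1 - t) H1t)) as Dpow.
    pose proof (is_Cderive_CPSeries _ _ (CV_radius_binomial_coef z t Ht1)) as Df.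
    pose proof (is_Cderive_mult _ _ _ _ _ Dpow Df) as Dprod.
    pose proof (CPSeries_binomial_ode z t Ht1) as Ode; fold f in Ode, Dprod.
    assert (Hnz : RtoC (1 - t) <> 0) by (apply RtoC_neq_0; lra).
    replace (RtoC 0) with (- (z * RtoC (/ (1 - t)) * Crpow (1 - t) z) * f t
      + Crpow (1 - t) z * CPSeries (CPS_derive (binomial_coef z)) t)%C; [exact Dprod|].
    replace (CPSeries (CPS_derive (binomial_coef z)) t) with (z * f t / RtoC (1 - t))%C
      by (rewrite <- Ode; field; exact Hnz).
    rewrite RtoC_inv by lra; field; exact Hnz. }
  assert (Hf0 : f 0 = RtoC 1).
  { unfold f, CPSeries; rewrite !PSeries_0; unfold binomial_coef; simpl.
    apply Ceq; simpl; field. }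
  rewrite Hf0, Rminus_0_r, Crpow_1_l, Cmult_1_l in Hconst.
  rewrite Crpow_opp; replace (/ Crpow (1 - y) z)%C with (f y).
  - apply CPSeries_correct, CV_radius_binomial_coef, Hy.
  - pose proof (Crpow_neq_0 (1 - y) z) as Hnz.
    rewrite <- (Cmult_1_l (/ _)), <- Hconst; field; exact Hnz.
Qed.

(** * Wallis integrals *)

Definition wallis (k : nat) : R := RInt (fun t => sin t ^ k) 0 PI.

Lemma is_derive_sin_pow k (t : R) :
  is_derive (fun t => sin t ^ k) t (INR k * cos t * sin t ^ pred k).
Proof. auto_derive; auto; ring. Qed.

Lemma ex_RInt_sin_pow k a b : ex_RInt (fun t => sin t ^ k) a b.
Proof.
  apply @ex_RInt_continuous; intros t _.
  apply (ex_derive_continuous (K := R_AbsRing) (V := R_NormedModule)).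
  eexists; apply is_derive_sin_pow.
Qed.

Lemma wallis_SS k : INR (S (S k)) * wallis (S (S k)) = INR (S k) * wallis k.
Proof.
  unfold wallis; apply Rminus_diag_uniq.
  set (F := fun t => - cos t * sin t ^ S k).
  transitivity (F PI - F 0); [|unfold F; rewrite sin_PI, sin_0; simpl; ring].
  rewrite <- !(RInt_scal (V := R_CompleteNormedModule)) by apply ex_RInt_sin_pow.
  rewrite <- (RInt_minus (V := R_CompleteNormedModule))
    by (apply (ex_RInt_scal (V := R_CompleteNormedModule)), ex_RInt_sin_pow).
  apply is_RInt_unique, (is_RInt_derive (V := R_CompleteNormedModule)).
  - intros t _; evar_last.
    { apply @is_derive_mult; [|apply is_derive_sin_pow|intros; apply Rmult_comm].
      auto_derive; auto; reflexivity. }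
    eqR; rewrite !S_INR; unfold minus, plus, opp, scal; simpl; unfold mult; simpl.
    transitivity ((sin t ^ 2 - (INR k + 1) * cos t ^ 2) * sin t ^ k); [simpl; ring|].
    replace (cos t ^ 2) with (1 - sin t ^ 2) by (rewrite sin_sqr; ring); ring.
  - intros t _; apply (continuous_minus (V := R_NormedModule));
      apply (continuous_scal_r (V := R_NormedModule));
      apply (ex_derive_continuous (K := R_AbsRing) (V := R_NormedModule));
      eexists; apply is_derive_sin_pow.
Qed.

Lemma wallis_even n : wallis (2 * n) = PI * Rpoch (/ 2) n / INR (fact n).
Proof.
  induction n as [|n IH].
  - unfold wallis; simpl; rewrite RInt_const; unfold scal; simpl; unfold mult; simpl; field.
  - pose proof (wallis_SS (2 * n)) as Hrec; rewrite IH in Hrec.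
    replace (2 * S n)%nat with (S (S (2 * n))) by lia.
    rewrite !S_INR, mult_INR in Hrec; change (INR 2) with 2 in Hrec.
    pose proof (pos_INR n).
    apply Rmult_eq_reg_l with (2 * INR n + 1 + 1); [|lra].
    rewrite Hrec, fact_simpl, mult_INR, S_INR; simpl Rpoch.
    field; split; [apply INR_fact_neq_0|lra].
Qed.

Lemma wallis_odd n : wallis (2 * n + 1) = INR (fact n) / Rpoch (/ 2) (S n).
Proof.
  rewrite <- (Rplus_0_l (/ 2)); change 0 with (INR 0); rewrite <- power_moment_even.
  apply is_RInt_unique; eapply is_RInt_ext; [|apply is_RInt_cos_sin; auto 10 with poly].
  intros th _; cbv beta; rewrite <- sin_sqr, <- pow_mult, pow_add; eqR; simpl; ring.
Qed.

Lemma wallis_decr k : wallis (S k) <= wallis k.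
Proof.
  pose proof PI_RGT_0.
  apply RInt_le; [lra| | |]; try apply ex_RInt_sin_pow.
  intros t Ht; pose proof (sin_gt_0 t ltac:(lra) ltac:(lra)); pose proof (SIN_bound t).
  simpl; rewrite <- (Rmult_1_l (sin t ^ k)) at 2; apply Rmult_le_compat_r; [apply pow_le|]; lra.
Qed.

Lemma Rpoch_half_fact_bounds n :
  (INR n + / 2) / PI <= (Rpoch (/ 2) (S n) / INR (fact n)) ^ 2 <= (INR n + 1) / PI.
Proof.
  pose proof PI_RGT_0; pose proof (pos_INR n); pose proof (INR_fact_lt_0 n) as Hf.
  pose proof (Rpoch_pos (/ 2) n ltac:(lra)) as Hp.
  pose proof (wallis_decr (2 * n)) as Hlow; rewrite <- Nat.add_1_r in Hlow.
  pose proof (wallis_decr (2 * n + 1)) as Hhigh.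
  replace (S (2 * n + 1)) with (2 * S n)%nat in Hhigh by lia.
  rewrite wallis_odd, wallis_even in Hlow, Hhigh.
  simpl Rpoch in *; rewrite fact_simpl, mult_INR, S_INR in Hhigh.
  set (x := INR n) in *; set (p := Rpoch (/ 2) n) in *; set (f := INR (fact n)) in *.
  set (q := p * (/ 2 + x) / f).
  assert (Hq : 0 < q) by (unfold q; apply Rdiv_lt_0_compat; [apply Rmult_lt_0_compat|]; lra).
  replace (f / (p * (/ 2 + x))) with (/ q) in Hlow, Hhigh by (unfold q; field; lra).
  replace (PI * p / f) with (PI / (x + / 2) * q) in Hlow by (unfold q; field; lra).
  replace (PI * (p * (/ 2 + x)) / ((x + 1) * f)) with (PI / (x + 1) * q) in Hhigh
    by (unfold q; field; lra).
  apply (Rmult_le_compat_r q) in Hlow; [|lra]; apply (Rmult_le_compat_r q) in Hhigh; [|lra].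
  rewrite Rinv_l in Hlow, Hhigh by lra.
  split.
  - apply Rmult_le_reg_l with (PI / (x + / 2)); [apply Rdiv_lt_0_compat; lra|].
    replace (PI / (x + / 2) * ((x + / 2) / PI)) with 1 by (field; lra); simpl; lra.
  - apply Rmult_le_reg_l with (PI / (x + 1)); [apply Rdiv_lt_0_compat; lra|].
    replace (PI / (x + 1) * ((x + 1) / PI)) with 1 by (field; lra); simpl; lra.
Qed.

(** * The reciprocal Gamma function *)

Lemma Crpow_one_minus_remainder (z : C) : exists B, 0 <= B /\ forall h, 0 <= h <= / 2 ->
  Cmod (Crpow (1 - h) z - (1 - z * RtoC h)) <= B * h ^ 2.
Proof.
  set (b := fun n => Rpoch (Cmod (- z) + 1) n / INR (fact n)).
  pose proof (Cmod_ge_0 (- z)) as Hz.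
  assert (Hb : forall n, 0 <= b n)
    by (intros n; left; apply Rdiv_lt_0_compat; [apply Rpoch_pos; lra|apply INR_fact_lt_0]).
  destruct (proj1 (ex_series_incr_n (fun n => b n * (/ 2) ^ n) 2)
    (ex_series_Rpoch (Cmod (- z) + 1) (/ 2) ltac:(lra) ltac:(lra))) as [T HT].
  assert (HT0 : 0 <= T).
  { apply Rle_trans with (sum_n (fun k => b (2 + k)%nat * (/ 2) ^ (2 + k)) 0).
    - rewrite sum_O; apply Rmult_le_pos; [apply Hb|apply pow_le; lra].
    - apply sum_n_le_series; [|exact HT].
      intros k; apply Rmult_le_pos; [apply Hb|apply pow_le; lra]. }
  exists (4 * T); split; [lra|]; intros h Hh.
  set (u := fun n => (binomial_coef (- z) n * RtoC (h ^ n))%C).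
  assert (Hu : is_Cseries u (Crpow (1 - h) z)).
  { replace z with (- - z)%C by ring; apply binomial_series; rewrite Rabs_right; lra. }
  apply (is_series_norm_le (V := C_NormedModule) (fun k => u (2 + k)%nat)
    (fun k => 4 * h ^ 2 * (b (2 + k)%nat * (/ 2) ^ (2 + k)))).
  - intros k; change (Cmod (u (2 + k)%nat) <= 4 * h ^ 2 * (b (2 + k)%nat * (/ 2) ^ (2 + k))).
    unfold u; rewrite Cmod_mult, Cmod_R, Rabs_right by (apply Rle_ge, pow_le; lra).
    replace (4 * h ^ 2 * (b (2 + k)%nat * (/ 2) ^ (2 + k)))
      with (b (2 + k)%nat * (h ^ 2 * (/ 2) ^ k)) by (simpl; field).
    apply Rmult_le_compat; [apply Cmod_ge_0|apply pow_le; lra|apply Cmod_binomial_coef_le|].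
    rewrite pow_add; apply Rmult_le_compat_l; [apply pow2_ge_0|apply pow_incr; lra].
  - apply (is_series_incr_n u); [lia|].
    replace (plus _ _) with (Crpow (1 - h) z); [exact Hu|].
    simpl pred; rewrite sum_Sn, sum_O; unfold u, binomial_coef, plus; simpl.
    rewrite !Rmult_1_r; eqC; field.
  - replace (4 * T * h ^ 2) with (4 * h ^ 2 * T) by ring.
    apply (is_series_scal (V := R_NormedModule) (4 * h ^ 2)), HT.
Qed.

Definition rgamma_seq (z : C) (N : nat) : C :=
  (Cpoch z (S N) / (RtoC (INR (fact N)) * Crpow (INR N) z))%C.

(* For [h = 1/(N+1)] this estimates the ratio of consecutive terms of [rgamma_seq]. *)
Lemma rgamma_ratio_bound (z : C) : exists B, 0 <= B /\ forall h, 0 <= h <= / 2 ->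
  Cmod ((1 + z * RtoC h) * Crpow (1 - h) z - 1) <= B * h ^ 2.
Proof.
  destruct (Crpow_one_minus_remainder z) as [B [HB Hrem]].
  exists ((1 + Cmod z) * B + Cmod z * Cmod z); pose proof (Cmod_ge_0 z) as Hz.
  split; [nra|]; intros h Hh; specialize (Hrem h Hh).
  replace ((1 + z * RtoC h) * Crpow (1 - h) z - 1)%C with
    ((1 + z * RtoC h) * (Crpow (1 - h) z - (1 - z * RtoC h)) + - (z * z * RtoC (h ^ 2)))%C
    by (rewrite RtoC_pow; ring).
  eapply Rle_trans; [apply Cmod_triangle|].
  rewrite Cmod_opp, !Cmod_mult, (Cmod_R (h ^ 2)), (Rabs_right (h ^ 2)) by apply Rle_ge, pow2_ge_0.
  rewrite Rmult_plus_distr_r; apply Rplus_le_compat; [|lra].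
  rewrite Rmult_assoc; apply Rmult_le_compat; auto using Cmod_ge_0.
  eapply Rle_trans; [apply Cmod_triangle|].
  rewrite Cmod_1, Cmod_mult, Cmod_R, Rabs_right by lra; nra.
Qed.

Lemma rgamma_seq_S z N : (0 < N)%nat ->
  rgamma_seq z (S N) = (rgamma_seq z N * ((1 + z * RtoC (/ INR (S N)))
                        * Crpow (1 - / INR (S N)) z))%C.
Proof.
  intros HN; assert (HN0 : 0 < INR N) by (apply lt_0_INR; auto).
  assert (HSN0 : 0 < INR (S N)) by (apply lt_0_INR; lia).
  assert (HSNC : RtoC (INR (S N)) <> 0) by (apply RtoC_neq_0; lra).
  replace (1 - / INR (S N)) with (INR N / INR (S N)) by (rewrite S_INR in *; field; lra).
  rewrite Crpow_div by auto; unfold rgamma_seq.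
  rewrite fact_simpl, mult_INR, RtoC_mult, RtoC_inv by lra.
  change (Cpoch z (S (S N))) with (Cpoch z (S N) * (z + RtoC (INR (S N))))%C.
  pose proof (Crpow_neq_0 (INR N) z); pose proof (Crpow_neq_0 (INR (S N)) z).
  pose proof (RtoC_fact_neq_0 N).
  field; auto.
Qed.

Lemma ex_series_inv_sqr : ex_series (fun n => (/ INR (S (S n))) ^ 2).
Proof.
  apply (ex_series_le (V := R_CompleteNormedModule) _ (fun n => / INR (S n) - / INR (S (S n)))).
  - intros n; change (Rabs ((/ INR (S (S n))) ^ 2) <= / INR (S n) - / INR (S (S n))).
    rewrite Rabs_right by apply Rle_ge, pow2_ge_0.
    rewrite !S_INR; pose proof (pos_INR n); set (x := INR n) in *.
    replace (/ (x + 1) - / (x + 1 + 1)) with (/ ((x + 1) * (x + 1 + 1))) by (field; lra).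
    replace ((/ (x + 1 + 1)) ^ 2) with (/ ((x + 1 + 1) * (x + 1 + 1))) by (field; lra).
    apply Rinv_le_contravar; nra.
  - eexists; apply (is_series_ext (fun n => minus (- / INR (S (S n))) (- / INR (S n)))).
    { intros n; unfold minus, plus, opp; simpl; eqR; ring. }
    apply (is_series_telescope (V := R_NormedModule) (fun n => - / INR (S n))).
    apply (is_lim_seq_opp (fun n => / INR (S n)) 0).
    apply (is_lim_seq_incr_1 (fun n => / INR n)), is_lim_seq_inv_INR.
Qed.

Lemma ex_Clim_rgamma_seq z : exists l, is_Clim_seq (rgamma_seq z) l.
Proof.
  destruct (rgamma_ratio_bound z) as [B [HB Hratio]].
  destruct (filterlim_relative_increment (V := C_CompleteNormedModule)
    (fun n => rgamma_seq z (S n)) (fun n => B * (/ INR (S (S n))) ^ 2)) as [l Hl].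
  - intros n; rewrite rgamma_seq_S by lia.
    set (g := rgamma_seq z (S n)); set (q := (_ * Crpow _ z)%C).
    change (Cmod (g * q - g) <= Cmod g * (B * (/ INR (S (S n))) ^ 2)).
    replace (g * q - g)%C with (g * (q - 1))%C by ring.
    rewrite Cmod_mult; apply Rmult_le_compat_l; [apply Cmod_ge_0|apply Hratio].
    rewrite !S_INR; pose proof (pos_INR n); split.
    + left; apply Rinv_0_lt_compat; lra.
    + apply Rinv_le_contravar; lra.
  - intros n; apply Rmult_le_pos; [exact HB|apply pow2_ge_0].
  - apply (ex_series_scal (V := R_NormedModule) B), ex_series_inv_sqr.
  - exists l; apply filterlim_eventually_S, Hl.
Qed.

Lemma is_Clim_rgamma_seq z : is_Clim_seq (rgamma_seq z) (rgamma z).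
Proof.
  destruct (ex_Clim_rgamma_seq z) as [l Hl].
  replace (rgamma z) with l; [exact Hl|symmetry; exact (Clim_seq_unique _ _ Hl)].
Qed.

Lemma Cpoch_add z j k : Cpoch z (j + k) = (Cpoch z j * Cpoch (z + RtoC (INR j)) k)%C.
Proof.
  induction k as [|k IH]; [rewrite Nat.add_0_r; simpl; ring|].
  rewrite Nat.add_succ_r; simpl; rewrite IH, plus_INR, RtoC_plus; ring.
Qed.

Lemma Cpoch_1 k : Cpoch 1 k = RtoC (INR (fact k)).
Proof.
  induction k as [|k IH]; [reflexivity|].
  rewrite fact_simpl, mult_INR, S_INR, RtoC_mult, RtoC_plus; simpl Cpoch; rewrite IH; ring.
Qed.

Lemma Cpoch_RtoC x k : Cpoch (RtoC x) k = RtoC (Rpoch x k).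
Proof.
  induction k as [|k IH]; [reflexivity|].
  simpl; rewrite IH, RtoC_mult, RtoC_plus; reflexivity.
Qed.

Lemma Cpoch_neq_0 z k : (forall j, (j < k)%nat -> (z + RtoC (INR j) <> 0)%C) -> Cpoch z k <> 0.
Proof.
  induction k as [|k IH]; intros Hz; simpl; [apply C1_nz|].
  apply Cmult_neq_0; [apply IH; intros; apply Hz; lia|apply Hz; lia].
Qed.

Lemma rgamma_step z : rgamma z = (z * rgamma (z + 1))%C.
Proof.
  rewrite <- (Clim_seq_unique (fun n => z * rgamma_seq (z + 1) n)%C (z * rgamma (z + 1))%C)
    by (apply is_Clim_seq_mult; [apply filterlim_const|apply is_Clim_rgamma_seq]).
  symmetry; apply Clim_seq_unique.
  apply (filterlim_ext_loc (fun n => rgamma_seq z n * (1 + (z + 1) * RtoC (/ INR n)))%C).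
  - exists 1%nat; intros n Hn.
    assert (Hn0 : 0 < INR n) by (apply lt_0_INR; lia).
    assert (HnC : RtoC (INR n) <> 0) by (apply RtoC_neq_0; lra).
    assert (Hpoch : (z * Cpoch (z + 1) (S n) = Cpoch z (S n) * (z + RtoC (INR n) + 1))%C).
    { transitivity (Cpoch z (1 + S n)); [rewrite Cpoch_add; simpl; ring|].
      change (Cpoch z (S n) * (z + RtoC (INR (S n))) = Cpoch z (S n) * (z + RtoC (INR n) + 1))%C.
      rewrite S_INR, RtoC_plus; ring. }
    unfold rgamma_seq, Cdiv; rewrite Cmult_assoc, Hpoch, Crpow_plus, Crpow_1_r, RtoC_inv by lra.
    pose proof (Crpow_neq_0 (INR n) z); pose proof (RtoC_fact_neq_0 n).
    field; auto.
  - replace (rgamma z) with (rgamma z * (1 + (z + 1) * RtoC 0))%C by ring.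
    apply is_Clim_seq_mult; [apply is_Clim_rgamma_seq|].
    apply is_Clim_seq_plus; [apply filterlim_const|].
    apply is_Clim_seq_mult; [apply filterlim_const|].
    apply is_Clim_seq_RtoC, is_lim_seq_inv_INR.
Qed.

Lemma rgamma_poch z k : rgamma z = (Cpoch z k * rgamma (z + RtoC (INR k)))%C.
Proof.
  induction k as [|k IH].
  - simpl; rewrite Cplus_0_r; ring.
  - rewrite IH, (rgamma_step (z + RtoC (INR k))); simpl Cpoch.
    rewrite S_INR, RtoC_plus, <- Cplus_assoc; ring.
Qed.

Lemma rgamma_1 : rgamma 1 = RtoC 1.
Proof.
  apply Clim_seq_unique.
  apply (filterlim_ext_loc (fun n => RtoC (1 + / INR n))).
  - exists 1%nat; intros n Hn.
    assert (Hn0 : 0 < INR n) by (apply lt_0_INR; lia).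
    assert (HnC : RtoC (INR n) <> 0) by (apply RtoC_neq_0; lra).
    rewrite Cpoch_1, Crpow_1_r by exact Hn0.
    rewrite fact_simpl, mult_INR, S_INR, RtoC_mult, !RtoC_plus, RtoC_inv by lra.
    pose proof (RtoC_fact_neq_0 n); field; auto.
  - apply is_Clim_seq_RtoC; replace (Finite 1) with (Finite (1 + 0)) by (f_equal; ring).
    apply is_lim_seq_plus'; [apply is_lim_seq_const|apply is_lim_seq_inv_INR].
Qed.

Lemma rgamma_S k : rgamma (RtoC (INR (S k))) = RtoC (/ INR (fact k)).
Proof.
  pose proof (rgamma_poch 1 k) as Hpoch; rewrite rgamma_1, Cpoch_1 in Hpoch.
  pose proof (RtoC_fact_neq_0 k) as Hk.
  rewrite S_INR, RtoC_plus, Cplus_comm, RtoC_inv by apply INR_fact_neq_0.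
  transitivity (RtoC (INR (fact k)) * rgamma (1 + RtoC (INR k)) / RtoC (INR (fact k)))%C.
  - field; exact Hk.
  - rewrite <- Hpoch; field; exact Hk.
Qed.

Lemma rgamma_nonpos k : rgamma (- RtoC (INR k)) = RtoC 0.
Proof.
  rewrite (rgamma_poch _ (S k)); simpl Cpoch.
  replace (- RtoC (INR k) + RtoC (INR k))%C with (RtoC 0) by ring; ring.
Qed.

Lemma Cinv_0 : (/ RtoC 0)%C = RtoC 0.
Proof. apply Ceq; simpl; unfold Rdiv; ring. Qed.

(* At a pole of Gamma at [z + k] both sides are [0], as [/ 0 = 0]. *)
Lemma CGamma_poch z k : (forall j, (j < k)%nat -> (z + RtoC (INR j) <> 0)%C) ->
  CGamma (z + RtoC (INR k)) = (CGamma z * Cpoch z k)%C.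
Proof.
  intros Hz; unfold CGamma; rewrite (rgamma_poch z k).
  pose proof (Cpoch_neq_0 z k Hz).
  set (g := rgamma (z + RtoC (INR k))).
  destruct (Ceq_dec g 0) as [Hg|Hg]; [rewrite Hg, Cmult_0_r, Cinv_0; ring|field; auto].
Qed.

Lemma is_lim_seq_Rpoch_half :
  is_lim_seq (fun n => Rpoch (/ 2) (S n) / (INR (fact n) * sqrt (INR n))) (/ sqrt PI).
Proof.
  pose proof PI_RGT_0 as Hpi.
  set (q := fun n => Rpoch (/ 2) (S n) / INR (fact n)).
  assert (Hq : forall n, 0 < q n)
    by (intros n; apply Rdiv_lt_0_compat; [apply Rpoch_pos; lra|apply INR_fact_lt_0]).
  assert (Hsq : is_lim_seq (fun n => q n ^ 2 / INR n) (/ PI)).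
  { assert (Hbound : forall c, is_lim_seq (fun n => / PI * (1 + c * / INR n)) (/ PI)).
    { intros c; replace (Finite (/ PI)) with (Finite (/ PI * (1 + c * 0))) by (f_equal; ring).
      apply is_lim_seq_mult'; [apply is_lim_seq_const|].
      apply is_lim_seq_plus'; [apply is_lim_seq_const|].
      apply is_lim_seq_mult'; [apply is_lim_seq_const|apply is_lim_seq_inv_INR]. }
    refine (is_lim_seq_le_le_loc _ _ _ _ _ (Hbound (/ 2)) (Hbound 1)).
    exists 1%nat; intros n Hn; assert (Hn0 : 0 < INR n) by (apply lt_0_INR; lia).
    pose proof (Rpoch_half_fact_bounds n) as [Hlow Hhigh]; fold (q n) in Hlow, Hhigh.
    replace (/ PI * (1 + / 2 * / INR n)) with ((INR n + / 2) / PI / INR n) by (field; lra).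
    replace (/ PI * (1 + 1 * / INR n)) with ((INR n + 1) / PI / INR n) by (field; lra).
    pose proof (Rinv_0_lt_compat _ Hn0).
    split; apply Rmult_le_compat_r; lra. }
  rewrite <- sqrt_inv.
  apply (is_lim_seq_ext_loc (fun n => sqrt (q n ^ 2 / INR n))).
  - exists 1%nat; intros n Hn; assert (Hn0 : 0 < INR n) by (apply lt_0_INR; lia).
    pose proof (sqrt_lt_R0 _ Hn0).
    rewrite sqrt_div_alt, sqrt_pow2 by (try apply Rlt_le, Hq; exact Hn0).
    unfold q; field; split; [lra|apply INR_fact_neq_0].
  - apply is_lim_seq_continuous; [|exact Hsq].
    apply continuity_pt_sqrt; left; apply Rinv_0_lt_compat, Hpi.
Qed.

Lemma rgamma_half : rgamma (RtoC (/ 2)) = RtoC (/ sqrt PI).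
Proof.
  apply Clim_seq_unique.
  apply (filterlim_ext_loc (fun n =>
    RtoC (Rpoch (/ 2) (S n) / (INR (fact n) * sqrt (INR n))))).
  - exists 1%nat; intros n Hn; assert (Hn0 : 0 < INR n) by (apply lt_0_INR; lia).
    pose proof (sqrt_lt_R0 _ Hn0) as Hsqrt.
    assert (Hpow : Crpow (INR n) (RtoC (/ 2)) = RtoC (sqrt (INR n))).
    { rewrite <- (Crpow_1_r (sqrt (INR n))), <- (Crpow_sqr (sqrt (INR n))), pow2_sqrt by lra.
      f_equal; rewrite RtoC_inv by lra; field. }
    rewrite Hpow, Cpoch_RtoC, <- RtoC_mult, <- RtoC_div; [reflexivity|].
    apply Rmult_integral_contrapositive_currified; [apply INR_fact_neq_0|lra].
  - apply is_Clim_seq_RtoC, is_lim_seq_Rpoch_half.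
Qed.

Lemma rgamma_half_nat k :
  rgamma (RtoC (INR k + / 2)) = RtoC (/ (sqrt PI * Rpoch (/ 2) k)).
Proof.
  pose proof (rgamma_poch (RtoC (/ 2)) k) as Hpoch.
  rewrite rgamma_half, Cpoch_RtoC, <- RtoC_plus, Rplus_comm in Hpoch.
  pose proof (Rpoch_pos (/ 2) k ltac:(lra)).
  rewrite Rinv_mult, RtoC_mult, Hpoch, Cmult_comm, Cmult_assoc, <- RtoC_mult.
  rewrite Rinv_l by lra; ring.
Qed.

(** * Ferrers functions as Gegenbauer polynomials *)

Definition ferrers_const (n m : nat) : C :=
  (Cpoch (RtoC (INR n) + 1) m * Cpoch (- RtoC (INR n)) m / RtoC (INR (fact m)))%C.

Lemma Cpoch_gegenbauer_coef d m l :
  (Cpoch (RtoC (INR (m + d)) + 1) (m + l) * Cpoch (- RtoC (INR (m + d))) (m + l)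
   * RtoC (/ INR (fact l)) / RtoC (INR (fact (m + l)))
   = ferrers_const (m + d) m * RtoC (gegenbauer_coef d (INR m) l))%C.
Proof.
  induction l as [|l IH].
  - rewrite Nat.add_0_r; unfold ferrers_const; simpl gegenbauer_coef; simpl fact; simpl INR.
    rewrite Rinv_1; unfold Cdiv; ring.
  - pose proof (pos_INR m) as Hm; pose proof (pos_INR l) as Hl.
    assert (HSl : RtoC (INR (S l)) <> 0) by (apply RtoC_neq_0, not_0_INR; lia).
    assert (HSml : RtoC (INR (S (m + l))) <> 0) by (apply RtoC_neq_0, not_0_INR; lia).
    assert (Hcoef : (RtoC (INR (S l)) * RtoC (INR (S (m + l)))
        * RtoC (gegenbauer_coef d (INR m) (S l))
      = RtoC (gegenbauer_coef d (INR m) l)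
        * ((RtoC (INR l) - RtoC (INR d))
           * (RtoC (INR l) + RtoC (INR d) + 2 * RtoC (INR m) + 1)))%C).
    { replace (INR (S (m + l))) with (INR (S l) + INR m) by (rewrite !S_INR, plus_INR; ring).
      rewrite <- !RtoC_mult, gegenbauer_coef_S by lra.
      rewrite <- RtoC_minus, <- !RtoC_plus, <- !RtoC_mult; f_equal; ring. }
    transitivity (ferrers_const (m + d) m * (RtoC (INR (S l)) * RtoC (INR (S (m + l)))
      * RtoC (gegenbauer_coef d (INR m) (S l))) / (RtoC (INR (S l)) * RtoC (INR (S (m + l)))))%C;
      [|field; auto].
    rewrite Hcoef, (Cmult_assoc (ferrers_const _ _)), <- IH, Nat.add_succ_r.
    change (Cpoch ?z (S ?k)) with (Cpoch z k * (z + RtoC (INR k)))%C.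
    rewrite !fact_simpl, !mult_INR, !RtoC_inv, !RtoC_mult
      by (try apply Rmult_integral_contrapositive_currified;
          try apply INR_fact_neq_0; apply not_0_INR; lia).
    rewrite !plus_INR, !RtoC_plus.
    pose proof (RtoC_fact_neq_0 l); pose proof (RtoC_fact_neq_0 (m + l)).
    field; auto.
Qed.

(* As [1/Gamma] vanishes at the nonpositive integers, the series starts at [y^m]. *)
Lemma hyp2F1reg_gegenbauer d m t :
  hyp2F1reg (RtoC (INR (m + d)) + 1) (- RtoC (INR (m + d))) (1 - RtoC (INR m))
    (RtoC ((1 - t) / 2))
  = (ferrers_const (m + d) m * RtoC (((1 - t) / 2) ^ m * gegenbauer d (INR m) t))%C.
Proof.
  set (y := (1 - t) / 2); apply Cseries_unique.
  apply (is_series_shift (V := C_NormedModule) _ m).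
  - intros k Hk; unfold zero; simpl.
    replace (1 - RtoC (INR m) + RtoC (INR k))%C with (- RtoC (INR (m - 1 - k)))%C.
    + rewrite rgamma_nonpos; unfold Cdiv; ring.
    + rewrite !minus_INR by lia; rewrite !RtoC_minus; simpl INR; ring.
  - set (v := fun l => (ferrers_const (m + d) m * RtoC (y ^ m)
      * RtoC (gegenbauer_coef d (INR m) l * y ^ l))%C).
    replace (_ * _)%C with (Csum_n v d).
    + apply (is_series_ext (V := C_NormedModule) v).
      * intros l; unfold v.
        replace (1 - RtoC (INR m) + RtoC (INR (m + l)))%C with (RtoC (INR (S l)))
          by (rewrite S_INR, plus_INR, !RtoC_plus; ring).
        rewrite rgamma_S, <- RtoC_pow, pow_add, !RtoC_mult.
        pose proof (Cpoch_gegenbauer_coef d m l) as Hcoef.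
        transitivity (ferrers_const (m + d) m * RtoC (gegenbauer_coef d (INR m) l)
          * (RtoC (y ^ m) * RtoC (y ^ l)))%C; [eqC; ring|].
        rewrite <- Hcoef; unfold Cdiv; eqC; ring.
      * apply (is_series_finite (V := C_NormedModule)); intros l Hl; unfold v.
        rewrite gegenbauer_coef_high, Rmult_0_l by exact Hl; apply Cmult_0_r.
    + unfold v; rewrite Csum_n_RtoC, RtoC_mult.
      unfold gegenbauer, gegenbauer_trunc; fold y; eqC; ring.
Qed.

Lemma FerrersP_cos d m th : 0 < th < PI ->
  FerrersP (RtoC (INR m)) (RtoC (INR (m + d))) (cos th)
  = (ferrers_const (m + d) m * RtoC ((sin th / 2) ^ m * gegenbauer d (INR m) (cos th)))%C.
Proof.
  intros Hth; unfold FerrersP; rewrite hyp2F1reg_gegenbauer.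
  pose proof (sin_gt_0 th ltac:(lra) ltac:(lra)) as Hs.
  pose proof (sin_sqr th) as Hsc; pose proof (COS_bound th).
  assert (Hc : cos th < 1) by nra.
  set (y := sin th / (1 - cos th)).
  assert (Hy : 0 < y) by (apply Rdiv_lt_0_compat; lra).
  replace ((1 + cos th) / (1 - cos th)) with (y ^ 2).
  2:{ unfold y; replace ((sin th / (1 - cos th)) ^ 2)
        with (sin th ^ 2 / (1 - cos th) ^ 2) by (field; lra).
      rewrite Hsc; field; lra. }
  rewrite Crpow_sqr, Crpow_nat by exact Hy.
  replace (sin th / 2) with (y * ((1 - cos th) / 2)) by (unfold y; field; lra).
  rewrite Rpow_mult_distr, !RtoC_mult; ring.
Qed.

(** * Expansions of the Legendre function of the second kind *)

Lemma Cpoch_double a k :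
  (Cpoch ((a + 1) / 2) k * Cpoch (a / 2) k * RtoC (4 ^ k))%C = Cpoch a (2 * k).
Proof.
  induction k as [|k IH]; [simpl; ring|].
  replace (2 * S k)%nat with (S (S (2 * k))) by lia.
  change (Cpoch a (S (S (2 * k)))) with
    (Cpoch a (2 * k) * (a + RtoC (INR (2 * k))) * (a + RtoC (INR (S (2 * k)))))%C.
  rewrite <- IH, S_INR, mult_INR, RtoC_plus, RtoC_mult.
  simpl; rewrite !RtoC_mult, !RtoC_plus; field.
Qed.

(* All the dependence of the Legendre functions on their order is carried by series
   with such terms. *)
Definition poch_term (a : C) (x : R) (g : nat -> R) (N : nat) : C :=
  (Cpoch a N * RtoC ((/ x) ^ N * g N))%C.

Lemma Cmod_poch_term_le a x g N : 1 < x -> Rabs (g N) <= / INR (fact N) ->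
  Cmod (poch_term a x g N) <= Rpoch (Cmod a + 1) N / INR (fact N) * (/ x) ^ N.
Proof.
  intros Hx Hg; pose proof (Rinv_0_lt_compat x ltac:(lra)) as Hinv.
  pose proof (pow_lt (/ x) N Hinv).
  unfold poch_term; rewrite Cmod_mult, Cmod_R, Rabs_mult, (Rabs_right ((/ x) ^ N)) by lra.
  replace (Rpoch (Cmod a + 1) N / INR (fact N) * (/ x) ^ N) with
    (Rpoch (Cmod a + 1) N * ((/ x) ^ N * / INR (fact N))) by (unfold Rdiv; ring).
  apply Rmult_le_compat; [apply Cmod_ge_0| |apply Cmod_Cpoch_le|].
  - apply Rmult_le_pos; [lra|apply Rabs_pos].
  - apply Rmult_le_compat_l; [lra|exact Hg].
Qed.

Lemma ex_series_poch_bound (a : C) x : 1 < x ->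
  ex_series (fun N => Rpoch (Cmod a + 1) N / INR (fact N) * (/ x) ^ N).
Proof.
  intros Hx; apply ex_series_Rpoch; [pose proof (Cmod_ge_0 a); lra|].
  split; [left; apply Rinv_0_lt_compat; lra|].
  rewrite <- Rinv_1; apply Rinv_lt_contravar; lra.
Qed.

Definition hyp2F1reg_term (a b c x : C) (k : nat) : C :=
  (Cpoch a k * Cpoch b k * rgamma (c + RtoC (INR k)) / RtoC (INR (fact k)) * x ^ k)%C.

Lemma Rabs_div_lt_1 p x : 0 < x -> Rabs p < x -> Rabs (p / x) < 1.
Proof.
  intros Hx Hp; apply Rabs_def2 in Hp; apply Rabs_def1.
  - apply Rmult_lt_reg_r with x; [lra|]; replace (p / x * x) with p by (field; lra); lra.
  - apply Rmult_lt_reg_r with x; [lra|]; replace (p / x * x) with p by (field; lra); lra.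
Qed.

Lemma hyp2F1reg_term_pow m (a : C) x p q k : 0 < x -> Rabs p < x ->
  (Crpow (1 - p / x) (- a)
   * hyp2F1reg_term ((a + 1) / 2) (a / 2) (RtoC (INR (m + 1))) (RtoC ((q / (x - p)) ^ 2)) k
   = Cpoch a (2 * k)
     * RtoC ((/ x) ^ (2 * k) * (q ^ (2 * k) / (4 ^ k * INR (fact k) * INR (fact (m + k)))))
     * Crpow (1 - p / x) (- (a + RtoC (INR (2 * k)))))%C.
Proof.
  intros Hx Hp; set (y := p / x).
  assert (H1y : 0 < 1 - y) by (pose proof (Rabs_def2 _ _ (Rabs_div_lt_1 p x Hx Hp)); unfold y; lra).
  pose proof (pow_lt _ (2 * k) H1y) as H1yk; pose proof (pow_lt 4 k ltac:(lra)) as H4k.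
  replace (- (a + RtoC (INR (2 * k))))%C with (- a + - RtoC (INR (2 * k)))%C by ring.
  rewrite Crpow_plus, (Crpow_opp _ (RtoC _)), Crpow_nat, <- Cpoch_double by exact H1y.
  unfold hyp2F1reg_term.
  replace (RtoC (INR (m + 1)) + RtoC (INR k))%C with (RtoC (INR (S (m + k))))
    by (rewrite <- RtoC_plus, <- plus_INR; do 2 f_equal; lia).
  replace (RtoC ((q / (x - p)) ^ 2) ^ k)%C
    with (RtoC ((/ x) ^ (2 * k) * q ^ (2 * k) / (1 - y) ^ (2 * k))).
  2:{ rewrite <- RtoC_pow, <- pow_mult; f_equal.
      replace (q / (x - p)) with (/ x * q * / (1 - y)).
      - rewrite !Rpow_mult_distr, !pow_inv; reflexivity.
      - unfold y; apply Rabs_def2 in Hp; field; split; lra. }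
  rewrite rgamma_S; unfold Rdiv.
  rewrite !RtoC_mult, !RtoC_inv by (repeat apply Rmult_integral_contrapositive_currified;
    try apply INR_fact_neq_0; lra).
  rewrite !RtoC_mult.
  pose proof (RtoC_fact_neq_0 k); pose proof (RtoC_fact_neq_0 (m + k)).
  pose proof (RtoC_neq_0 _ (Rgt_not_eq _ _ H1yk)); pose proof (RtoC_neq_0 _ (Rgt_not_eq _ _ H4k)).
  field; auto.
Qed.

Lemma kernel_column_series m (a : C) x p q k : 0 < x -> Rabs p < x ->
  is_Cseries
    (poch_term a x (fun N => kernel_coef m N k * p ^ (N - 2 * k) * q ^ (2 * k)))
    (Crpow (1 - p / x) (- a)
     * hyp2F1reg_term ((a + 1) / 2) (a / 2) (RtoC (INR (m + 1)))
         (RtoC ((q / (x - p)) ^ 2)) k)%C.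
Proof.
  intros Hx Hp; rewrite hyp2F1reg_term_pow by assumption.
  apply (is_series_shift (V := C_NormedModule) _ (2 * k)).
  { intros N HN; unfold poch_term; rewrite kernel_coef_high by exact HN.
    rewrite !Rmult_0_l, Rmult_0_r; apply Cmult_0_r. }
  eapply is_Cseries_scal;
    [|exact (binomial_series (a + RtoC (INR (2 * k))) _ (Rabs_div_lt_1 p x Hx Hp))].
  intros j; cbv beta; unfold poch_term, kernel_coef, binomial_coef.
  rewrite (proj2 (Nat.leb_le _ _)) by lia.
  replace (2 * k + j - 2 * k)%nat with j by lia.
  unfold Rdiv, Cdiv; rewrite Cpoch_add, pow_add, Rpow_mult_distr, !Rinv_mult.
  rewrite <- (RtoC_inv (INR (fact j))), !RtoC_mult by apply INR_fact_neq_0; eqC; ring.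
Qed.

Definition kernel_form_series (m : nat) (a : C) (x p q : R) : C :=
  Cseries (poch_term a x (fun N => kernel_form m N N p q)).

(* Both sides are sums of the same double series: by [kernel_column_series] the
   columns sum to the terms of the left-hand side. *)
Lemma hyp2F1reg_kernel_form_series m (a : C) x p q : 1 < x -> Rabs p + Rabs q <= 1 ->
  hyp2F1reg ((a + 1) / 2) (a / 2) (RtoC (INR (m + 1))) (RtoC ((q / (x - p)) ^ 2))
  = (Crpow (1 - p / x) a * kernel_form_series m a x p q)%C.
Proof.
  intros Hx Hpq; pose proof (Rabs_pos q).
  set (cell := fun N k => poch_term a x
    (fun N => kernel_coef m N k * p ^ (N - 2 * k) * q ^ (2 * k)) N).
  assert (Hcell : forall N n, Csum_n (cell N) n
      = poch_term a x (fun N => kernel_form m N n p q) N).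
  { intros N n; unfold cell, poch_term.
    rewrite (sum_n_ext _ (fun k => Cpoch a N * RtoC ((/ x) ^ N)
      * RtoC (kernel_coef m N k * p ^ (N - 2 * k) * q ^ (2 * k)))%C)
      by (intros k; rewrite RtoC_mult; eqC; ring).
    rewrite Csum_n_RtoC, (RtoC_mult ((/ x) ^ N)); unfold kernel_form; eqC; ring. }
  edestruct (is_series_swap (V := C_CompleteNormedModule) cell
    (fun N => Rpoch (Cmod a + 1) N / INR (fact N) * (/ x) ^ N)
    (poch_term a x (fun N => kernel_form m N N p q))) as [l [Hrows Hcols]].
  - intros N n; change (Cmod (Csum_n (cell N) n)
      <= Rpoch (Cmod a + 1) N / INR (fact N) * (/ x) ^ N).
    rewrite Hcell; apply Cmod_poch_term_le, Rabs_kernel_form_le; assumption.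
  - apply ex_series_poch_bound, Hx.
  - intros N; replace (poch_term _ _ _ N) with (Csum_n (cell N) N) by apply (Hcell N N).
    apply (is_series_finite (V := C_NormedModule)); intros k Hk; unfold cell, poch_term.
    rewrite kernel_coef_high, !Rmult_0_l, Rmult_0_r by lia; apply Cmult_0_r.
  - intros k; apply kernel_column_series; lra.
  - unfold kernel_form_series; rewrite (Cseries_unique _ _ Hrows).
    apply Cseries_unique; eapply is_Cseries_scal; [|exact Hcols].
    intros k; cbv beta; rewrite Crpow_opp.
    pose proof (Crpow_neq_0 (1 - p / x) a).
    unfold hyp2F1reg_term; field; split; [apply RtoC_fact_neq_0|assumption].
Qed.

Lemma LegendreQ_kernel_form_series m (mu : C) x p q : 1 < x -> 0 < q -> Rabs p + q <= 1 ->
  let a := (RtoC (INR m) + mu + 1 / 2)%C in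
  let chi := (x - p) / q in
  LegendreQ mu (RtoC (INR m) - RtoC (1 / 2)) chi
  = (Cexp (mu * RtoC PI * Ci) * RtoC (sqrt PI) * CGamma a * Crpow (chi ^ 2 - 1) (mu / 2)
     / Crpow 2 (RtoC (INR m) + 1 / 2) * (Crpow q a / Crpow x a)
     * kernel_form_series m a x p q)%C.
Proof.
  intros Hx Hq Hpq a chi.
  assert (Hpx : Rabs p < x) by lra; apply Rabs_def2 in Hpx.
  assert (H1p : 0 < 1 - p / x).
  { replace (1 - p / x) with ((x - p) / x) by (field; lra); apply Rdiv_lt_0_compat; lra. }
  assert (Hhalf : RtoC (1 / 2) = (1 / 2)%C) by (rewrite RtoC_div by lra; reflexivity).
  assert (Hthree_halves : RtoC (3 / 2) = (3 / 2)%C) by (rewrite RtoC_div by lra; reflexivity).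
  unfold LegendreQ; rewrite Hhalf, Hthree_halves.
  replace (RtoC (INR m) - 1 / 2 + mu + 1)%C with a by (unfold a; field).
  replace ((RtoC (INR m) - 1 / 2 + mu) / 2 + 1)%C with ((a + 1) / 2)%C by (unfold a; field).
  replace (RtoC (INR m) - 1 / 2 + 1)%C with (RtoC (INR m) + 1 / 2)%C by field.
  replace (RtoC (INR m) - 1 / 2 + 3 / 2)%C with (RtoC (INR (m + 1)))
    by (rewrite plus_INR, RtoC_plus; simpl INR; field).
  replace (/ chi ^ 2) with ((q / (x - p)) ^ 2) by (unfold chi; field; split; lra).
  rewrite hyp2F1reg_kernel_form_series by (try rewrite (Rabs_right q); lra).
  replace (Crpow chi a) with (Crpow x a * Crpow (1 - p / x) a / Crpow q a)%C.
  - pose proof (Crpow_neq_0 x a); pose proof (Crpow_neq_0 q a).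
    pose proof (Crpow_neq_0 (1 - p / x) a); pose proof (Crpow_neq_0 2 (RtoC (INR m) + 1 / 2)).
    field; auto.
  - rewrite <- Crpow_mult, <- Crpow_div by (try apply Rmult_lt_0_compat; lra).
    f_equal; unfold chi; field; lra.
Qed.

(** * Termwise integration of the kernel series *)

Lemma norm_C_R (z : C) : norm (V := C_R_NormedModule) z = Cmod z.
Proof.
  unfold Cmod, norm; simpl; unfold prod_norm, norm; simpl; unfold abs; simpl.
  rewrite !Rmult_1_r, <- !Rabs_mult, !Rabs_right by apply Rle_ge, Rle_0_sqr; reflexivity.
Qed.

Notation is_CRInt := (is_RInt (V := C_R_NormedModule)).

Lemma is_CRInt_iff (f : R -> C) a b (l : C) :
  is_CRInt f a b l <->
  is_RInt (fun t => Re (f t)) a b (Re l) /\ is_RInt (fun t => Im (f t)) a b (Im l).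
Proof.
  split.
  - intros Hf; split.
    + exact (is_RInt_fct_extend_fst (U := R_NormedModule) (V := R_NormedModule) f a b l Hf).
    + exact (is_RInt_fct_extend_snd (U := R_NormedModule) (V := R_NormedModule) f a b l Hf).
  - intros [HRe HIm]; destruct l as [lRe lIm].
    exact (is_RInt_fct_extend_pair (U := R_NormedModule) (V := R_NormedModule)
      f a b lRe lIm HRe HIm).
Qed.

Lemma is_CRInt_scal (c : C) (f : R -> C) a b (l : C) :
  is_CRInt f a b l -> is_CRInt (fun t => c * f t)%C a b (c * l)%C.
Proof.
  intros Hf; apply is_CRInt_iff in Hf; destruct Hf as [HRe HIm].
  apply is_CRInt_iff; split; simpl.
  - apply @is_RInt_minus; apply @is_RInt_scal; auto.
  - apply @is_RInt_plus; apply @is_RInt_scal; auto.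
Qed.

Lemma is_CRInt_RtoC (f : R -> R) a b l :
  is_RInt f a b l -> is_CRInt (fun t => RtoC (f t)) a b (RtoC l).
Proof.
  intros Hf; apply is_CRInt_iff; split; simpl; [exact Hf|].
  evar_last; [apply (is_RInt_const (V := R_NormedModule))|apply Rmult_0_r].
Qed.

Lemma gegenbauer_cos_bounded d mu :
  exists B, 0 <= B /\ forall th, Rabs (gegenbauer d mu (cos th)) <= B.
Proof.
  exists (sum_f_R0 (fun l => Rabs (gegenbauer_coef d mu l)) d); split.
  - apply cond_pos_sum; intros; apply Rabs_pos.
  - intros th; eapply Rle_trans; [apply Rsum_abs|].
    apply sum_Rle; intros l _; rewrite Rabs_mult, <- RPow_abs.
    rewrite <- (Rmult_1_r (Rabs (gegenbauer_coef d mu l))) at 2.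
    apply Rmult_le_compat_l; [apply Rabs_pos|].
    apply Rle_trans with (1 ^ l); [|rewrite pow1; lra].
    apply pow_incr; split; [apply Rabs_pos|].
    pose proof (COS_bound th); apply Rabs_le; lra.
Qed.

Definition moment_series (d m : nat) (a : C) (x : R) : C :=
  Cseries (poch_term a x (scaled_moment d m)).

Definition kernel_series (m : nat) (a : C) (x th th' : R) : C :=
  kernel_form_series m a x (cos th * cos th') (sin th * sin th').

Lemma is_Cseries_kernel m (a : C) x th th' : 1 < x ->
  is_Cseries (poch_term a x (fun N => kernel m N (cos th) (cos th'))) (kernel_series m a x th th').
Proof.
  intros Hx.
  apply (is_series_ext (V := C_NormedModule)
    (poch_term a x (fun N => kernel_form m N N (cos th * cos th') (sin th * sin th')))).
  - intros N; unfold poch_term; rewrite kernel_cos; reflexivity.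
  - destruct (ex_series_le (V := C_CompleteNormedModule)
      (poch_term a x (fun N => kernel_form m N N (cos th * cos th') (sin th * sin th')))
      _ (fun N => Cmod_poch_term_le a x _ N Hx
        (Rabs_kernel_form_le m N N _ _ (Rabs_cos_sin_le th th')))
      (ex_series_poch_bound a x Hx)) as [l Hl].
    exact (Cseries_correct _ l Hl).
Qed.

Lemma is_CRInt_kernel_series_termwise d m (a : C) x th' : 1 < x -> exists l,
  is_Cseries (poch_term a x (fun N => scaled_moment d m N * gegenbauer d (INR m) (cos th'))) l /\
  is_CRInt (fun th => kernel_series m a x th th'
      * RtoC (sin th ^ (2 * m + 1) * gegenbauer d (INR m) (cos th)))%C 0 PI l.
Proof.
  intros Hx; destruct (gegenbauer_cos_bounded d (INR m)) as [B [HB HYB]].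
  set (w := fun th => sin th ^ (2 * m + 1) * gegenbauer d (INR m) (cos th)).
  assert (Hw : forall th, Rabs (w th) <= B).
  { intros th; unfold w; rewrite Rabs_mult, <- RPow_abs, <- (Rmult_1_l B).
    apply Rmult_le_compat; [apply pow_le, Rabs_pos|apply Rabs_pos| |apply HYB].
    rewrite <- (pow1 (2 * m + 1)); apply pow_incr; split; [apply Rabs_pos|].
    pose proof (SIN_bound th); apply Rabs_le; lra. }
  set (bound := fun N => Rpoch (Cmod a + 1) N / INR (fact N) * (/ x) ^ N).
  apply (is_RInt_series (V := C_R_CompleteNormedModule)
    (fun N th => poch_term a x (fun N => kernel m N (cos th) (cos th')) N * RtoC (w th))%C
    (fun N => B * bound N)).
  - intros N th; rewrite (norm_C_R (_ * _)%C), Cmod_mult, Cmod_R, Rmult_comm.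
    apply Rmult_le_compat; [apply Rabs_pos|apply Cmod_ge_0|apply Hw|].
    apply Cmod_poch_term_le, Rabs_kernel_le; exact Hx.
  - apply (ex_series_scal (V := R_NormedModule) B), ex_series_poch_bound, Hx.
  - intros N; unfold poch_term.
    apply (is_RInt_ext (V := C_R_NormedModule) (fun th => Cpoch a N * RtoC ((/ x) ^ N)
      * RtoC (kernel m N (cos th) (cos th') * w th))%C).
    { intros th _; rewrite !RtoC_mult; eqC; ring. }
    rewrite RtoC_mult, Cmult_assoc; apply is_CRInt_scal, is_CRInt_RtoC.
    apply is_RInt_kernel_gegenbauer.
  - intros th; rewrite Cmult_comm.
    eapply is_Cseries_scal; [|apply is_Cseries_kernel, Hx].
    intros N; apply Cmult_comm.
Qed.

Lemma is_Cseries_moment d m (a : C) x : 1 < x ->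
  is_Cseries (poch_term a x (scaled_moment d m)) (moment_series d m a x).
Proof.
  intros Hx; destruct (is_CRInt_kernel_series_termwise d m a x 0 Hx) as [l [Hl _]].
  apply (Cseries_correct _ l); revert Hl.
  apply (is_series_ext (V := C_NormedModule)); intros N.
  unfold poch_term; rewrite cos_0, gegenbauer_at_1, Rmult_1_r; reflexivity.
Qed.

Lemma is_CRInt_kernel_series d m (a : C) x th' : 1 < x ->
  is_CRInt (fun th => kernel_series m a x th th'
      * RtoC (sin th ^ (2 * m + 1) * gegenbauer d (INR m) (cos th)))%C 0 PI
    (RtoC (gegenbauer d (INR m) (cos th')) * moment_series d m a x)%C.
Proof.
  intros Hx; destruct (is_CRInt_kernel_series_termwise d m a x th' Hx) as [l [Hl Hint]].
  replace (_ * moment_series d m a x)%C with l; [exact Hint|].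
  apply (is_Cseries_unique _ _ _ Hl).
  eapply is_Cseries_scal; [|exact (is_Cseries_moment d m a x Hx)].
  intros N; unfold poch_term; rewrite !RtoC_mult; ring.
Qed.

Lemma hyp2F1reg_moment_series d m (a : C) x : 1 < x ->
  (forall j : nat, (a + RtoC (INR j) <> 0)%C) ->
  hyp2F1reg ((a + RtoC (INR d) + 1) / 2) ((a + RtoC (INR d)) / 2)
    (RtoC (INR (m + d) + 3 / 2)) (RtoC (/ x ^ 2))
  = (RtoC ((2 * x) ^ d) / (Cpoch a d * RtoC (sqrt PI)) * moment_series d m a x)%C.
Proof.
  intros Hx Ha; pose proof (is_Cseries_moment d m a x Hx) as Hconv; apply Cseries_unique.
  assert (Hpoch : Cpoch a d <> 0) by (apply Cpoch_neq_0; auto).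
  pose proof (sqrt_lt_R0 _ PI_RGT_0) as Hpi.
  apply (is_series_shift (V := C_NormedModule) _ d) in Hconv.
  2:{ intros N HN; unfold poch_term; rewrite scaled_moment_low, Rmult_0_r by exact HN.
      apply Cmult_0_r. }
  apply (is_series_even (V := C_NormedModule)) in Hconv.
  2:{ intros k; unfold poch_term; rewrite scaled_moment_odd, Rmult_0_r; apply Cmult_0_r. }
  eapply is_Cseries_scal; [|exact Hconv].
  intros k; cbv beta; unfold poch_term; rewrite scaled_moment_even, Cpoch_add, <- Cpoch_double.
  replace (RtoC (INR (m + d) + 3 / 2) + RtoC (INR k))%C
    with (RtoC (INR (m + d + 1 + k) + / 2))
    by (rewrite <- RtoC_plus, !plus_INR; simpl INR; f_equal; field).
  rewrite rgamma_half_nat.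
  pose proof (Rpoch_pos (/ 2) (m + d + 1 + k) ltac:(lra)) as HR.
  pose proof (pow_lt 2 d ltac:(lra)); pose proof (pow_lt x d ltac:(lra)).
  pose proof (pow_lt 4 k ltac:(lra)); pose proof (pow_lt x (2 * k) ltac:(lra)).
  set (A := / (sqrt PI * Rpoch (/ 2) (m + d + 1 + k))).
  replace ((/ x) ^ (d + 2 * k) * / (2 ^ (d + 2 * k) * INR (fact k) * Rpoch (/ 2) (m + d + 1 + k)))
    with (sqrt PI / (2 * x) ^ d / 4 ^ k * (A / INR (fact k) * (/ x ^ 2) ^ k)).
  2:{ unfold A; rewrite Rpow_mult_distr, !pow_inv, <- pow_mult, !pow_add, (pow_mult 2).
      replace (2 ^ 2) with 4 by ring.
      field; repeat split; try apply INR_fact_neq_0; lra. }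
  assert (H2xd : (2 * x) ^ d <> 0) by (apply pow_nonzero; lra).
  rewrite !RtoC_mult, !RtoC_div, (RtoC_pow (/ x ^ 2)) by (try apply INR_fact_neq_0; lra).
  pose proof (RtoC_fact_neq_0 k); pose proof (RtoC_neq_0 _ H2xd).
  assert (RtoC (4 ^ k) <> 0) by (apply RtoC_neq_0; lra).
  assert (RtoC (sqrt PI) <> 0) by (apply RtoC_neq_0; lra).
  eqC; field; auto.
Qed.

Lemma LegendreQ_moment_series d m (mu : C) x : 1 < x ->
  let a := (RtoC (INR m) + mu + 1)%C in
  (forall j : nat, (a + RtoC (INR j) <> 0)%C) ->
  LegendreQ mu (RtoC (INR (m + d))) x
  = (Cexp (mu * RtoC PI * Ci) * CGamma a * Crpow (x ^ 2 - 1) (mu / 2)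
     / (RtoC (2 ^ (m + 1)) * Crpow x a) * moment_series d m a x)%C.
Proof.
  intros Hx a Ha; unfold LegendreQ.
  assert (Had : (RtoC (INR (m + d)) + mu + 1 = a + RtoC (INR d))%C)
    by (unfold a; rewrite plus_INR, RtoC_plus; ring).
  replace ((RtoC (INR (m + d)) + mu) / 2 + 1)%C with ((a + RtoC (INR d) + 1) / 2)%C
    by (rewrite <- Had; field).
  rewrite Had, <- (RtoC_plus (INR (m + d)) (3 / 2)).
  rewrite hyp2F1reg_moment_series, CGamma_poch by auto.
  replace (RtoC (INR (m + d)) + 1)%C with (RtoC (INR (m + 1 + d)))
    by (rewrite <- RtoC_plus; f_equal; rewrite !plus_INR; simpl INR; ring).
  rewrite Crpow_plus, !Crpow_nat, pow_add, Rpow_mult_distr, !RtoC_mult by lra.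
  pose proof (Crpow_neq_0 x a).
  assert (Cpoch a d <> 0) by (apply Cpoch_neq_0; auto).
  assert (RtoC (2 ^ (m + 1)) <> 0) by (apply RtoC_neq_0, pow_nonzero; lra).
  assert (RtoC (2 ^ d) <> 0) by (apply RtoC_neq_0, pow_nonzero; lra).
  assert (RtoC (x ^ d) <> 0) by (apply RtoC_neq_0, pow_nonzero; lra).
  assert (RtoC (sqrt PI) <> 0)
    by (apply RtoC_neq_0; pose proof (sqrt_lt_R0 _ PI_RGT_0); lra).
  field; repeat split; auto.
Qed.

(** * The integral formula *)

Definition LegendreQ_FerrersP_const (d m : nat) (mu : C) (x th' : R) : C :=
  let a := (RtoC (INR m) + mu + 1 / 2)%C in
  (Cexp (mu * RtoC PI * Ci) * RtoC (sqrt PI) * CGamma a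
   / Crpow 2 (RtoC (INR m) + 1 / 2) * (Crpow (sin th') a / Crpow x a)
   * ferrers_const (m + d) m / RtoC (2 ^ m))%C.

Lemma LegendreQ_FerrersP_integrand d m (mu : C) x th th' :
  1 < x -> 0 < th < PI -> 0 < th' < PI ->
  let chi := (x - cos th * cos th') / (sin th * sin th') in
  (Crpow (chi ^ 2 - 1) (- (mu / 2)) * LegendreQ mu (RtoC (INR m) - RtoC (1 / 2)) chi
   * FerrersP (RtoC (INR m)) (RtoC (INR (m + d))) (cos th) * Crpow (sin th) (1 / 2 - mu)
   = LegendreQ_FerrersP_const d m mu x th'
     * (kernel_series m (RtoC (INR m) + mu + 1 / 2) x th th'
        * RtoC (sin th ^ (2 * m + 1) * gegenbauer d (INR m) (cos th))))%C.
Proof.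
  intros Hx Hth Hth' chi; unfold chi.
  pose proof (sin_gt_0 th ltac:(lra) ltac:(lra)) as Hs.
  pose proof (sin_gt_0 th' ltac:(lra) ltac:(lra)) as Hs'.
  assert (Hss : 0 < sin th * sin th') by (apply Rmult_lt_0_compat; lra).
  pose proof (Rabs_cos_sin_le th th') as Hcs; rewrite (Rabs_right (sin th * _)) in Hcs by lra.
  rewrite LegendreQ_kernel_form_series, FerrersP_cos by auto.
  fold (kernel_series m (RtoC (INR m) + mu + 1 / 2) x th th').
  set (a := (RtoC (INR m) + mu + 1 / 2)%C); set (X := _ ^ 2 - 1).
  assert (Hsin : Crpow (sin th) (1 / 2 - mu) = (RtoC (sin th ^ (m + 1)) / Crpow (sin th) a)%C).
  { rewrite <- Crpow_nat by exact Hs; unfold Cdiv; rewrite <- Crpow_opp, <- Crpow_plus.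
    f_equal; unfold a; rewrite plus_INR, RtoC_plus; simpl INR; field. }
  rewrite Hsin, Crpow_opp, Crpow_mult by assumption.
  unfold LegendreQ_FerrersP_const; fold a.
  replace (sin th ^ (2 * m + 1)) with (sin th ^ m * sin th ^ (m + 1))
    by (rewrite <- pow_add; f_equal; lia).
  unfold Rdiv; rewrite Rpow_mult_distr, pow_inv, !RtoC_mult, (RtoC_inv (2 ^ m))
    by (apply pow_nonzero; lra).
  pose proof (Crpow_neq_0 X (mu / 2)); pose proof (Crpow_neq_0 2 (RtoC (INR m) + 1 / 2)).
  pose proof (Crpow_neq_0 (sin th) a); pose proof (Crpow_neq_0 x a).
  assert (RtoC (2 ^ m) <> 0) by (apply RtoC_neq_0, pow_nonzero; lra).
  field; repeat split; auto.
Qed.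

Lemma Ci_mult_Cexp (w : C) :
  (Ci * Cexp ((w - 1 / 2) * RtoC PI * Ci) = Cexp (w * RtoC PI * Ci))%C.
Proof.
  replace (w * RtoC PI * Ci)%C with ((w - 1 / 2) * RtoC PI * Ci + RtoC (PI / 2) * Ci)%C
    by (rewrite RtoC_div by lra; field).
  rewrite Cexp_plus, Cexp_RtoC_Ci, cos_PI2, sin_PI2; apply Cmult_comm.
Qed.

Lemma LegendreQ_FerrersP_value d m (mu : C) x th' : 1 < x -> 0 < th' < PI ->
  (forall j : nat, (RtoC (INR m) + mu + 1 / 2 + RtoC (INR j) <> 0)%C) ->
  (Ci * RtoC (sqrt PI) * Crpow 2 mu * Crpow (sin th') (mu + 1 / 2)
   * Crpow (4 * (x ^ 2 - 1)) ((1 / 2 - mu) / 2)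
   * LegendreQ (mu - 1 / 2) (RtoC (INR (m + d))) x
   * FerrersP (RtoC (INR m)) (RtoC (INR (m + d))) (cos th')
   = LegendreQ_FerrersP_const d m mu x th'
     * (RtoC (gegenbauer d (INR m) (cos th'))
        * moment_series d m (RtoC (INR m) + mu + 1 / 2) x))%C.
Proof.
  intros Hx Hth' Ha; pose proof (sin_gt_0 th' ltac:(lra) ltac:(lra)) as Hs.
  set (a := (RtoC (INR m) + mu + 1 / 2)%C) in *.
  assert (Ea : (RtoC (INR m) + (mu - 1 / 2) + 1 = a)%C) by (unfold a; field).
  rewrite LegendreQ_moment_series, FerrersP_cos, Ea by (rewrite ?Ea; auto).
  unfold LegendreQ_FerrersP_const; fold a; rewrite <- (Ci_mult_Cexp mu).
  assert (Hx2 : 0 < x ^ 2 - 1) by nra.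
  assert (Hpow : (Crpow (4 * (x ^ 2 - 1)) ((1 / 2 - mu) / 2) * Crpow (x ^ 2 - 1) ((mu - 1 / 2) / 2)
    = Crpow 2 (1 / 2 - mu))%C).
  { rewrite Crpow_mult by lra; replace 4 with (2 ^ 2) by ring; rewrite Crpow_sqr by lra.
    rewrite <- Cmult_assoc, <- Crpow_plus.
    replace ((1 / 2 - mu) / 2 + (mu - 1 / 2) / 2)%C with (RtoC 0) by field.
    rewrite Crpow_0; ring. }
  assert (Hpow2 : (Crpow 2 mu * Crpow 2 (1 / 2 - mu) * Crpow 2 (RtoC (INR m) + 1 / 2)
    = RtoC (2 ^ (m + 1)))%C).
  { rewrite <- Crpow_nat, <- !Crpow_plus by lra; f_equal.
    rewrite plus_INR, RtoC_plus; simpl INR; field. }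
  assert (Hsin : Crpow (sin th') a = (Crpow (sin th') (mu + 1 / 2) * RtoC (sin th' ^ m))%C).
  { rewrite <- Crpow_nat, <- Crpow_plus by exact Hs; f_equal; unfold a; field. }
  rewrite Hsin, <- Hpow2, <- Hpow.
  unfold Rdiv; rewrite Rpow_mult_distr, pow_inv, !RtoC_mult, (RtoC_inv (2 ^ m))
    by (apply pow_nonzero; lra).
  pose proof (Crpow_neq_0 2 mu); pose proof (Crpow_neq_0 2 (RtoC (INR m) + 1 / 2)).
  pose proof (Crpow_neq_0 (4 * (x ^ 2 - 1)) ((1 / 2 - mu) / 2)).
  pose proof (Crpow_neq_0 (x ^ 2 - 1) ((mu - 1 / 2) / 2)); pose proof (Crpow_neq_0 x a).
  assert (RtoC (2 ^ m) <> 0) by (apply RtoC_neq_0, pow_nonzero; lra).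
  field; repeat split; auto.
Qed.

Lemma is_CRInt_LegendreQ_FerrersP d m (mu : C) x th' (chi : R -> R) :
  1 < x -> 0 < th' < PI ->
  (forall j : nat, (RtoC (INR m) + mu + 1 / 2 + RtoC (INR j) <> 0)%C) ->
  (forall th, 0 < th < PI -> chi th = (x - cos th * cos th') / (sin th * sin th')) ->
  is_CRInt
    (fun th => Crpow (chi th ^ 2 - 1) (- (mu / 2))
       * LegendreQ mu (RtoC (INR m) - RtoC (1 / 2)) (chi th)
       * FerrersP (RtoC (INR m)) (RtoC (INR (m + d))) (cos th)
       * Crpow (sin th) (1 / 2 - mu))%C
    0 PI
    (Ci * RtoC (sqrt PI) * Crpow 2 mu * Crpow (sin th') (mu + 1 / 2)
     * Crpow (4 * (x ^ 2 - 1)) ((1 / 2 - mu) / 2)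
     * LegendreQ (mu - 1 / 2) (RtoC (INR (m + d))) x
     * FerrersP (RtoC (INR m)) (RtoC (INR (m + d))) (cos th'))%C.
Proof.
  intros Hx Hth' Ha Hchi; rewrite LegendreQ_FerrersP_value by assumption.
  eapply is_RInt_ext; [|apply is_CRInt_scal, is_CRInt_kernel_series, Hx].
  intros th Hth; pose proof PI_RGT_0; rewrite Rmin_left, Rmax_right in Hth by lra.
  rewrite Hchi by exact Hth; symmetry; apply LegendreQ_FerrersP_integrand; assumption.
Qed.

Lemma Rmax_sqr_minus_Rmin_sqr r r' : 0 < r -> 0 < r' -> r <> r' ->
  0 < (Rmax r r' ^ 2 - Rmin r r' ^ 2) / (r * r') /\
  ((Rmax r r' ^ 2 - Rmin r r' ^ 2) / (r * r')) ^ 2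
  = 4 * (((r ^ 2 + r' ^ 2) / (2 * r * r')) ^ 2 - 1).
Proof.
  intros Hr Hr' Hrr'; assert (0 < r * r') by (apply Rmult_lt_0_compat; assumption).
  unfold Rmax, Rmin; destruct (Rle_dec r r');
    (split; [apply Rdiv_lt_0_compat; nra|field; lra]).
Qed.

Lemma one_lt_sum_sqr_div r r' : 0 < r -> 0 < r' -> r <> r' ->
  1 < (r ^ 2 + r' ^ 2) / (2 * r * r').
Proof.
  intros Hr Hr' Hrr'; assert (0 < r * r') by (apply Rmult_lt_0_compat; assumption).
  apply Rmult_lt_reg_r with (2 * r * r'); [lra|].
  replace (_ / _ * _) with (r ^ 2 + r' ^ 2) by (field; lra).
  assert (0 < (r - r') ^ 2) by (apply pow2_gt_0; lra); simpl in *; lra.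
Qed.
Lemma order_shift_neq_0 (m : nat) (nu : C) :
  (forall k : nat, nu <> RtoC (INR (2 * m + 2 * k))) ->
  forall j : nat, (RtoC (INR m) + - ((nu + 1) / 2) + 1 / 2 + RtoC (INR j) <> 0)%C.
Proof.
  intros Hnu j E; apply (Hnu j); rewrite plus_INR, !mult_INR, RtoC_plus, !RtoC_mult.
  replace nu with (2 * (RtoC (INR m) + RtoC (INR j))
    - 2 * (RtoC (INR m) + - ((nu + 1) / 2) + 1 / 2 + RtoC (INR j)))%C by field.
  rewrite E; simpl INR; rewrite RtoC_plus; ring.
Qed.

Lemma toroidal_variable_eq r r' th th' : 0 < r -> 0 < r' -> 0 < th < PI -> 0 < th' < PI ->
  (r ^ 2 + r' ^ 2 - 2 * r * r' * cos th * cos th') / (2 * r * r' * sin th * sin th')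
  = ((r ^ 2 + r' ^ 2) / (2 * r * r') - cos th * cos th') / (sin th * sin th').
Proof.
  intros Hr Hr' [Hth0 HthPI] [Hth'0 Hth'PI].
  pose proof (sin_gt_0 th Hth0 HthPI); pose proof (sin_gt_0 th' Hth'0 Hth'PI).
  field; lra.
Qed.


Theorem theorem3p1 (n m : nat) (nu : C) (r r' th' : R) :
  (m <= n)%nat ->
  (forall k : nat, nu <> RtoC (INR (2 * m + 2 * k))) ->
  0 < r -> 0 < r' -> r <> r' ->
  0 < th' < PI ->
  let chi := fun th : R =>
    (r ^ 2 + r' ^ 2 - 2 * r * r' * cos th * cos th')
      / (2 * r * r' * sin th * sin th') in
  let rl := Rmin r r' in
  let rg := Rmax r r' in
  is_RInt (V := C_R_NormedModule)
    (fun th : R =>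
       (Crpow (chi th ^ 2 - 1) ((nu + 1) / 4)
        * LegendreQ (- ((nu + 1) / 2)) (RtoC (INR m) - RtoC (1 / 2)) (chi th)
        * FerrersP (RtoC (INR m)) (RtoC (INR n)) (cos th)
        * Crpow (sin th) ((nu + 2) / 2))%C)
    0 PI
    (Ci * RtoC (sqrt PI)
       / (Crpow 2 ((nu + 1) / 2) * Crpow (sin th') (nu / 2))
       * Crpow ((rg ^ 2 - rl ^ 2) / (r * r')) ((nu + 2) / 2)
       * LegendreQ (- ((nu + 2) / 2)) (RtoC (INR n))
                   ((r ^ 2 + r' ^ 2) / (2 * r * r'))
       * FerrersP (RtoC (INR m)) (RtoC (INR n)) (cos th'))%C.
Proof.
  intros Hmn Hnu Hr Hr' Hrr' Hth' chi rl rg.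
  replace n with (m + (n - m))%nat by lia.
  destruct (Rmax_sqr_minus_Rmin_sqr r r' Hr Hr' Hrr') as [HD HD2].
  fold rg rl in HD, HD2; set (D := (rg ^ 2 - rl ^ 2) / (r * r')) in *.
  set (x := (r ^ 2 + r' ^ 2) / (2 * r * r')) in *; set (mu := (- ((nu + 1) / 2))%C).
  pose proof (is_CRInt_LegendreQ_FerrersP (n - m) m mu x th' chi
    (one_lt_sum_sqr_div r r' Hr Hr' Hrr') Hth' (order_shift_neq_0 m nu Hnu)
    (fun th Hth => toroidal_variable_eq r r' th th' Hr Hr' Hth Hth')) as Hint.
  replace (- (mu / 2))%C with ((nu + 1) / 4)%C in Hint by (unfold mu; field).
  replace (1 / 2 - mu)%C with ((nu + 2) / 2)%C in Hint by (unfold mu; field).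
  replace (mu - 1 / 2)%C with (- ((nu + 2) / 2))%C in Hint by (unfold mu; field).
  replace (mu + 1 / 2)%C with (- (nu / 2))%C in Hint by (unfold mu; field).
  rewrite <- HD2, Crpow_sqr in Hint by exact HD.
  evar_last; [exact Hint|unfold mu; rewrite !Crpow_opp].
  pose proof (Crpow_neq_0 2 ((nu + 1) / 2)); pose proof (Crpow_neq_0 (sin th') (nu / 2)).
  eqC; field; auto.
Qed.
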